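(* Let $\kappa$ be a regular uncountable cardinal and let $\mathbb{A}$ be a large subalgebra of the $\kappa$-Souslin algebra $\mathbb{B}$. Then: (a) $\mathbb{A}$ is a nice subalgebra of $\mathbb{B}$. (b) There is a group $G$ of automorphisms of $\mathbb{B}$ with $|G|<\kappa$ such that $\mathbb{A}=\{x\in\mathbb{B}\mid(\forall\varphi\in G)\ \varphi(x)=x\}$; moreover, if $\mu$ is the least cardinal such that $\mathbb{A}$ is $\mu$-large in $\mathbb{B}$, then $G$ can be chosen of size $\aleph_0\cdot\mu$. (c) There are a maximal antichain $N$ of $\mathbb{A}$ and a map $f$ assigning a cardinal $f(a)$ to each $a\in N$ such that $\mathbb{B}\cong\prod_{a\in N}(\mathbb{A}\upharpoonright a)^{f(a)}$. (d) If $\mathbb{B}$ is homogeneous, then $\mathbb{A}$ and $\mathbb{B}$ are isomorphic.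
   Context: All Boolean algebras are complete and subalgebras are complete and regular; $\langle M\rangle^{\mathrm{cm}}$ is the complete subalgebra generated by $M$, $\mathbb{A}\upharpoonright a=\{x\in\mathbb{A}:x\le a\}$. A $\kappa$-Souslin algebra is a complete Boolean algebra with the $\kappa$-chain condition and the $(\kappa,\infty)$-distributive law; throughout only those having a Souslinization are considered, where a Souslinization of $\mathbb{B}$ is a dense subset $T\subseteq\mathbb{B}\setminus\{0\}$ such that $(T,>_{\mathbb{B}})$ is a normal $\kappa$-Souslin tree and every node of limit height is the product of its tree-predecessors. A subalgebra $\mathbb{A}$ is large in $\mathbb{B}$ if there is an antichain $M$ of $\mathbb{B}$ with $\langle\mathbb{A}\cup M\rangle^{\mathrm{cm}}=\mathbb{B}$, and $\mu$-large if such $M$ exists of size $\mu$. $\mathbb{A}$ is nice in $\mathbb{B}$ if some Souslinization $T$ of $\mathbb{B}$ has $h''T$ a Souslinization of $\mathbb{A}$, where $h(b)=\prod\{a\in\mathbb{A}:b\le a\}$. $\mathbb{B}$ is homogeneous if $\mathbb{B}\upharpoonright b\cong\mathbb{B}$ for every $b\in\mathbb{B}\setminus\{0\}$.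
   Formalization: The clause of (b) that G can be chosen of size ℵ₀·μ is stated only for μ ≥ 1, i.e. for A a proper subalgebra; if A = B then μ = 0 and G must be the trivial group, which does not have size ℵ₀·μ. *)

(* Defs.v *)
From HB Require Import structures.
From mathcomp Require Import all_boot all_order.
From mathcomp Require Import boolp classical_sets functions cardinality.

Set Implicit Arguments.
Unset Strict Implicit.
Unset Printing Implicit Defensive.

Import Order.Theory.
Local Open Scope classical_set_scope.
Local Open Scope card_scope.
Local Open Scope order_scope.

(* mathcomp-classical equips [I -> L] with its pointwise lattice structure
   only; here the remaining Boolean operations are added, also pointwise. *)
Section PointwiseBoolean.
Context (I : Type) (d : Order.disp_t) (L : ctbDistrLatticeType d).
Implicit Types f g h : I -> L.

Fact fun_le0x f : (fun=> \bot) <= f.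
Proof. by apply/lefP => i; exact: le0x. Qed.

Fact fun_lex1 f : f <= (fun=> \top).
Proof. by apply/lefP => i; exact: lex1. Qed.

Fact fun_meetUl : @left_distributive (I -> L) (I -> L) Order.meet Order.join.
Proof. by move=> f g h; apply/funext => i; exact: meetUl. Qed.

HB.instance Definition _ :=
  Order.hasBottom.Build _ (I -> L) fun_le0x.
HB.instance Definition _ :=
  Order.hasTop.Build _ (I -> L) fun_lex1.
HB.instance Definition _ :=
  Order.Lattice_Meet_isDistrLattice.Build _ (I -> L) fun_meetUl.

Fact fun_joinxC f : f `|` (fun i => ~` f i) = \top.
Proof. by apply/funext => i; exact: joinxC. Qed.

Fact fun_meetxC f : f `&` (fun i => ~` f i) = \bot.
Proof. by apply/funext => i; exact: meetxC. Qed.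

HB.instance Definition _ :=
  Order.TBDistrLattice_hasComplement.Build _ (I -> L) fun_joinxC fun_meetxC.

End PointwiseBoolean.

Definition card_lt (T U : Type) (X : set T) (Y : set U) : Prop :=
  X #<= Y /\ ~ (Y #<= X).

(* Cardinals are initial ordinals: [K] is well-ordered and every proper initial
   segment is smaller than [K]. Thus ordinals below kappa are elements of K. *)
Definition regular_uncountable (d : Order.disp_t) (K : orderType d) : Prop :=
  [/\ well_founded (fun x y : K => x < y),
      forall a : K, card_lt [set b : K | b < a] [set: K],
      ~ countable [set: K]
    & forall S : set K,
        (forall a, exists2 s, S s & a <= s) -> [set: K] #<= S].

Definition limit_ordinal (d : Order.disp_t) (K : orderType d) (a : K) : Prop :=
  (exists b, b < a) /\ forall b, b < a -> exists2 c, b < c & c < a.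

(* A set T of elements of a poset is viewed as a tree growing downwards. *)
Section Trees.
Context (dP : Order.disp_t) (P : porderType dP).
Context (dK : Order.disp_t) (K : orderType dK).
Implicit Types (T C : set P) (s t u : P) (a : K).

Definition tree_preds T t : set P := [set s | T s /\ t < s].

Definition is_tree T : Prop :=
  forall t, T t -> forall S : set P, S `<=` tree_preds T t -> S !=set0 ->
    exists2 s, S s & forall u, S u -> u <= s.

Definition tree_level T a : set P :=
  [set t | T t /\ exists f : P -> K,
     set_bij (tree_preds T t) [set b | b < a] f /\
     forall s u, tree_preds T t s -> tree_preds T t u -> (f s < f u) = (u < s)].

Definition has_tree_height T : Prop :=
  (forall t, T t -> exists a, tree_level T a t) /\
  (forall a, tree_level T a !=set0).

Definition tree_chain T C : Prop :=
  C `<=` T /\ forall s t, C s -> C t -> s >=< t.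

Definition tree_antichain T C : Prop :=
  C `<=` T /\ forall s t, C s -> C t -> s <> t -> s >< t.

Definition souslin_tree T : Prop :=
  [/\ is_tree T, has_tree_height T,
      forall C, tree_chain T C -> card_lt C [set: K]
    & forall C, tree_antichain T C -> card_lt C [set: K]].

Definition immediate_successor T t s : Prop :=
  [/\ T s, s < t & ~ exists u, [/\ T u, s < u & u < t]].

Definition normal_tree T : Prop :=
  [/\ exists2 r, T r & forall t, T t -> t <= r,
      forall t, T t -> exists s1 s2,
        [/\ immediate_successor T t s1, immediate_successor T t s2 & s1 <> s2],
      forall (a b : K) t, tree_level T a t -> a < b ->
        exists2 s, tree_level T b s & s < t
    & forall (a : K) s t, limit_ordinal a ->
        tree_level T a s -> tree_level T a t ->
        tree_preds T s = tree_preds T t -> s = t].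

End Trees.

Section BooleanAlgebras.
Context (d : Order.disp_t) (B : ctbDistrLatticeType d).
Implicit Types (A M N S : set B) (a b x y : B).

Definition complete_algebra : Prop := forall S, supremums S !=set0.

Definition bsup S : B := supremum \bot S.
Definition binf S : B := infimum \top S.

(* Suprema are those of B, so this says both that A is a complete algebra and
   that it is a regular subalgebra; S = set0 gives \bot. *)
Definition complete_subalgebra A : Prop :=
  (forall x, A x -> A (~` x)) /\ (forall S, S `<=` A -> A (bsup S)).

Definition antichain M : Prop :=
  ~ M \bot /\ forall x y, M x -> M y -> x <> y -> x `&` y = \bot.

Definition generates_over A M : Prop :=
  smallest complete_subalgebra (A `|` M) = [set: B].

Definition large A : Prop := exists2 M, antichain M & generates_over A M.

(* The cardinal mu is represented by a type of that size. With the antichain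
   M = set0, A is 0-large in B exactly when A = B. *)
Definition mu_large (mu : Type) A : Prop :=
  exists M, [/\ antichain M, M #= [set: mu] & generates_over A M].

Definition least_mu_large (mu : Type) A : Prop :=
  mu_large mu A /\ forall nu : Type, mu_large nu A -> [set: mu] #<= [set: nu].

Definition maximal_antichain_in A N : Prop :=
  [/\ N `<=` A, antichain N
    & forall N', N' `<=` A -> antichain N' -> N `<=` N' -> N' = N].

Definition relative_algebra A a : set B := [set x | A x /\ x <= a].

Definition upper_projection A b : B := binf [set a | A a /\ b <= a].

Section Kappa.
Context (dK : Order.disp_t) (K : orderType dK).

Definition kappa_cc : Prop :=
  forall M, antichain M -> card_lt M [set: K].

(* The index set I has size < kappa: with kappa-many factors the law would
   contradict the existence of a Souslinization. *)
Definition kappa_distributive : Prop :=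
  forall (I J : Type) (b : I -> J -> B), card_lt [set: I] [set: K] ->
    binf (range (fun i => bsup (range (b i)))) =
    bsup (range (fun f : I -> J => binf (range (fun i => b i (f i))))).

Definition souslinization A (T : set B) : Prop :=
  [/\ T `<=` A, ~ T \bot,
      forall a, A a -> a <> \bot -> exists2 t, T t & t <= a,
      souslin_tree K T /\ normal_tree K T
    & forall (a : K) t, limit_ordinal a -> tree_level T a t ->
        t = binf (tree_preds T t)].

Definition souslin_algebra : Prop :=
  [/\ complete_algebra, kappa_cc, kappa_distributive
    & exists T, souslinization setT T].

Definition nice A : Prop :=
  exists2 T, souslinization setT T
           & souslinization A [set upper_projection A t | t in T].

End Kappa.
End BooleanAlgebras.

(* [P] with greatest element [p] is a Boolean algebra under the meet and join
   of [L] and the complement [p `\` x]; similarly [Q] in [L']. *)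
Definition boolean_isomorphism (d d' : Order.disp_t)
    (L : ctbDistrLatticeType d) (L' : ctbDistrLatticeType d')
    (P : set L) (p : L) (Q : set L') (q : L') (f : L -> L') : Prop :=
  [/\ set_bij P Q f,
      forall x y, P x -> P y -> f (x `&` y) = f x `&` f y,
      forall x y, P x -> P y -> f (x `|` y) = f x `|` f y
    & forall x, P x -> f (p `\` x) = q `\` f x].

Definition boolean_isomorphic (d d' : Order.disp_t)
    (L : ctbDistrLatticeType d) (L' : ctbDistrLatticeType d')
    (P : set L) (p : L) (Q : set L') (q : L') : Prop :=
  exists f, boolean_isomorphism P p Q q f.

Section Automorphisms.
Context (d : Order.disp_t) (B : ctbDistrLatticeType d).

Definition homogeneous : Prop :=
  forall b : B, b <> \bot ->
    boolean_isomorphic (relative_algebra setT b) b [set: B] \top.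

Definition automorphism (phi : B -> B) : Prop :=
  boolean_isomorphism [set: B] \top [set: B] \top phi.

Definition automorphism_group (G : set (B -> B)) : Prop :=
  [/\ G `<=` automorphism, G idfun,
      forall phi psi, G phi -> G psi -> G (phi \o psi)
    & forall phi, G phi ->
        exists psi, [/\ G psi, cancel phi psi & cancel psi phi]].

Definition fixed_points (G : set (B -> B)) : set B :=
  [set x | forall phi, G phi -> phi x = x].

(* The product over a in N of the powers (A |` a)^(f a), as the set of families
   indexed by the pairs (a, i) with a in N and i in f a. *)
Definition power_index (N : set B) (f : N -> Type) : Type := {a : N & f a}.

Definition power_top (N : set B) (f : N -> Type) : power_index f -> B :=
  fun j => val (projT1 j).

Definition product_of_powers (A N : set B) (f : N -> Type) :
    set (power_index f -> B) :=
  [set g | forall j, relative_algebra A (power_top j) (g j)].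

End Automorphisms.

Arguments power_top {d B N} f _.
Arguments product_of_powers {d B} A {N} f _.

(* Main.v *)
(** Let [h] be the upper projection onto [A] and [M] a maximal antichain generating
    [B] over [A]. Each [m] in [M] is a relative atom: every [x <= m] is [h x & m].
    By distributivity a maximal antichain [N] of [A] decides all the [h m], which
    gives (c); choosing one [m] over each [a] in [N] and summing the [a & m] gives a
    relative atom [p] with [h p = 1], so that [A] is isomorphic to [B] below [p],
    whence (d). For (a), the part of a Souslinization of [B] that lies below [p] and
    above a large enough level is copied below each [m], resp. projected to [A]; the
    club of surviving levels is renumbered. For (b), the exchanges of the copies of
    [A] below [h m & h n] over [m] and over [n] have [A] as set of common fixed
    points; since [M \ A] still generates [B], there are enough exchanges to meet
    the cardinality [aleph_0 * mu], countably many being added when [mu] is finite. *)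
Require Import Defs.
From mathcomp Require Import all_boot all_order.
From mathcomp Require Import boolp classical_sets functions cardinality.

Set Implicit Arguments.
Unset Strict Implicit.
Unset Printing Implicit Defensive.

Import Order.Theory.
Local Open Scope classical_set_scope.
Local Open Scope card_scope.
Local Open Scope order_scope.

(** * Deciding Boolean inclusions by truth tables *)

(** Niceness asks for one tree whose image under [h] is again a Souslinization, so the tree for the
    whole algebra and the tree for [A] must come from the same nodes. Both are instances of one
    construction: given a complete subalgebra [C] containing [A] and an antichain [Q] of relative
    atoms of [C] with join [\top], a node [t] below the meet of [p] and [h q] is copied to the meet
    of [h t] and [q]. The pair [setT], [M] gives the first tree, the pair [A], [[set \top]] the
    second; projecting a copy returns [h t], which forgets [q]. A node of small rank may meet such a
    product without lying below it. As [M] has fewer than kappa elements, some level [c] decides all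
    these products, and of the smaller ranks only a new root is kept. In (b) the delicate half is
    the lower bound on the group: a swap determines its two relative atoms only up to order, so an
    element outside [A] is coded by a swap together with one bit. *)

Inductive bterm : Type :=
  | BVar of nat | BBot | BTop
  | BMeet of bterm & bterm | BJoin of bterm & bterm | BCompl of bterm.

Section TruthTables.
Context (d : Order.disp_t) (L : ctbDistrLatticeType d).
Implicit Types (x y z : L) (e : seq L) (t : bterm) (r : seq bool).

Fixpoint beval e t : L :=
  match t with
  | BVar i => nth \bot e i
  | BBot => \bot
  | BTop => \top
  | BMeet t1 t2 => beval e t1 `&` beval e t2
  | BJoin t1 t2 => beval e t1 `|` beval e t2
  | BCompl t1 => ~` beval e t1
  end.

Fixpoint btruth r t : bool :=
  match t with
  | BVar i => nth false r i
  | BBot => false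
  | BTop => true
  | BMeet t1 t2 => btruth r t1 && btruth r t2
  | BJoin t1 t2 => btruth r t1 || btruth r t2
  | BCompl t1 => ~~ btruth r t1
  end.

(** [r] lists the values already chosen for the first variables; [n] counts the variables still to
    be split. *)
Fixpoint btautology n r t : bool :=
  if n is n'.+1 then btautology n' (rcons r true) t && btautology n' (rcons r false) t
  else btruth r t.

Fixpoint minterm e r : L :=
  match e, r with
  | x :: e', b :: r' => (if b then x else ~` x) `&` minterm e' r'
  | _, _ => \top
  end.

Lemma minterm_nth e r i : (size r <= size e)%N -> (i < size r)%N ->
  minterm e r <= (if nth false r i then nth \bot e i else ~` nth \bot e i).
Proof.
elim: e r i => [|x e IH] [|b r] [|i] //= sre sir; first exact: leIl.
by apply: le_trans (IH r i _ _) => //; exact: leIr.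
Qed.

Lemma minterm_rcons e r x b :
  size r = size e ->
  minterm (rcons e x) (rcons r b) = minterm e r `&` (if b then x else ~` x).
Proof.
elim: e r => [|y e IH] [|c r] //= => [_|[sre]]; first by rewrite meetx1 meet1x.
by rewrite IH // meetA.
Qed.

Lemma minterm_beval e r t : size r = size e ->
  if btruth r t then minterm e r <= beval e t else minterm e r <= ~` beval e t.
Proof.
move=> sre; elim: t => [i| | |t1 IH1 t2 IH2|t1 IH1 t2 IH2|t1 IH1] /=.
- case: (ltnP i (size r)) => ir.
    by have := @minterm_nth e r i; rewrite sre leqnn -sre ir => /(_ isT isT); case: nth.
  by rewrite !nth_default -?sre // compl0 lex1.
- by rewrite compl0 lex1.
- by rewrite lex1.
- move: IH1 IH2; case: (btruth r t1); case: (btruth r t2) => /= h1 h2;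
    rewrite ?complI ?lexI ?h1 ?h2 //.
  + exact: le_trans h2 (leUr _ _).
  + exact: le_trans h1 (leUl _ _).
  + exact: le_trans h1 (leUl _ _).
- move: IH1 IH2; case: (btruth r t1); case: (btruth r t2) => /= h1 h2;
    rewrite ?complU ?lexI ?h1 ?h2 //.
  + exact: le_trans h1 (leUl _ _).
  + exact: le_trans h1 (leUl _ _).
  + exact: le_trans h2 (leUr _ _).
- by move: IH1; case: (btruth r t1) => /=; rewrite ?complK.
Qed.

(** [minterm e1 r] is the join of its meets with the next variable and with the complement of that
    variable, which are the minterms of the two recursive calls. *)
Lemma btautology_minterm e2 e1 r t : size r = size e1 ->
  btautology (size e2) r t -> minterm e1 r <= beval (e1 ++ e2) t.
Proof.
elim: e2 e1 r => [|x e2 IH] e1 r sre /= => [tr|/andP[tt tf]].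
  by have := @minterm_beval e1 r t sre; rewrite cats0 tr.
rewrite -cat_rcons.
have hs b : size (rcons r b) = size (rcons e1 x) by rewrite !size_rcons sre.
have := IH (rcons e1 x) _ (hs true) tt; have := IH (rcons e1 x) _ (hs false) tf.
rewrite !minterm_rcons //= => h1 h2.
by rewrite -[minterm e1 r]meetx1 -(joinxC x) meetUr leUx h1 h2.
Qed.

Lemma btautology_le e t1 t2 :
  btautology (size e) [::] (BJoin (BCompl t1) t2) -> beval e t1 <= beval e t2.
Proof.
move=> /(@btautology_minterm e [::]) /= /(_ erefl); rewrite le1x => /eqP h.
by rewrite -[beval e t1]meetx1 -h meetUr meetxC join0x leIr.
Qed.

(** Under the hypothesis the added factor equals [\top]; this moves the hypothesis into the goal,
    where the truth table can use it. *)
Lemma assume_le (a b x y : L) : a <= b -> x `&` (~` a `|` b) <= y -> x <= y.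
Proof.
move=> ab; suff -> : ~` a `|` b = \top by rewrite meetx1.
by apply/eqP; rewrite -le1x -(joinxC a) joinC leU2.
Qed.

Lemma assume_eq (a b x y : L) : a = b ->
  x `&` ((~` a `|` b) `&` (~` b `|` a)) <= y -> x <= y.
Proof. by move=> ->; rewrite meetxx [~` b `|` b]joinC joinxC meetx1. Qed.

End TruthTables.

Ltac batom_index x e :=
  lazymatch e with
  | ?y :: ?e' =>
    match constr:(Set) with
    | _ => let _ := match constr:(Set) with _ => constr_eq x y end in constr:(O)
    | _ => let i := batom_index x e' in constr:(S i)
    end
  end.

Ltac batoms_add x e :=
  match constr:(Set) with
  | _ => let _ := batom_index x e in e
  | _ => constr:(x :: e)
  end.

Ltac batoms t e :=
  lazymatch t with
  | Order.meet ?x ?y => let e' := batoms x e in batoms y e'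
  | Order.join ?x ?y => let e' := batoms x e in batoms y e'
  | Order.diff ?x ?y => let e' := batoms x e in batoms y e'
  | Order.compl ?x => batoms x e
  | Order.bottom => e
  | Order.top => e
  | _ => batoms_add t e
  end.

Ltac breify t e :=
  lazymatch t with
  | Order.meet ?x ?y =>
    let x' := breify x e in let y' := breify y e in constr:(BMeet x' y')
  | Order.join ?x ?y =>
    let x' := breify x e in let y' := breify y e in constr:(BJoin x' y')
  | Order.compl ?x => let x' := breify x e in constr:(BCompl x')
  | Order.bottom => constr:(BBot)
  | Order.top => constr:(BTop)
  | _ => let i := batom_index t e in constr:(BVar i)
  end.

Ltac bdecide_le L :=

  lazymatch goal with
  | |- is_true (Order.le ?x ?y) =>
    let e0 := batoms x (@nil L) in
    let e := batoms y e0 in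
    let t1 := breify x e in
    let t2 := breify y e in
    apply: (@btautology_le _ L e t1 t2); vm_compute; reflexivity
  end.

Ltac bassume L :=
  lazymatch goal with
  | |- forall _ : is_true (Order.le ?a ?b), _ =>
    let h := fresh in move=> h; bassume L;
    apply: (@assume_le _ L a b _ _ h); clear h
  | |- forall _ : ?a = ?b, _ =>
    let h := fresh in move=> h; bassume L;
    apply: (@assume_eq _ L a b _ _ h); clear h
  | |- is_true (Order.le _ _) => idtac
  | |- _ = _ => apply: le_anti; apply/andP; split
  end.

(* [ba L] proves a Boolean (in)equality in [L] that follows propositionally from
   the (in)equalities in front of the goal. *)
Ltac ba L := bassume L; rewrite ?diffE; bdecide_le L.

(** * Complete subalgebras and upper projections *)

Section Complete.
Context (d : Order.disp_t) (B : ctbDistrLatticeType d) (cB : complete_algebra B).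
Implicit Types (S C M : set B) (x y z : B).

Lemma bsup_ub S x : S x -> x <= bsup S.
Proof.
move=> Sx; rewrite /bsup /supremum; case: ifPn => [/eqP S0|_].
  by rewrite S0 in Sx.
by case: xgetP => [z -> [zS _]|nS]; [exact: zS | case: (cB S) => z /nS].
Qed.

Lemma bsup_le S y : (forall x, S x -> x <= y) -> bsup S <= y.
Proof.
move=> Sy; rewrite /bsup /supremum; case: ifPn => _; first exact: le0x.
by case: xgetP => [z -> [_ lz]|nS]; [exact: lz | case: (cB S) => z /nS].
Qed.

Lemma infimums_neq0 S : infimums S !=set0.
Proof.
have [z [zub zl]] := cB (lbound S); exists z; split => [x Sx|x]; last exact: zub.
by apply: zl => y; exact.
Qed.

Lemma binf_lb S x : S x -> binf S <= x.
Proof.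
move=> Sx; rewrite /binf /infimum; case: ifPn => [/eqP S0|_].
  by rewrite S0 in Sx.
by case: xgetP => [z -> [zS _]|nS]; [exact: zS | case: (infimums_neq0 S) => z /nS].
Qed.

Lemma le_binf S y : (forall x, S x -> y <= x) -> y <= binf S.
Proof.
move=> Sy; rewrite /binf /infimum; case: ifPn => _; first exact: lex1.
by case: xgetP => [z -> [_ lz]|nS]; [exact: lz | case: (infimums_neq0 S) => z /nS].
Qed.

Lemma meet_bsup_le S y z : (forall x, S x -> x `&` y <= z) -> bsup S `&` y <= z.
Proof.
move=> Sy; suff : bsup S <= ~` y `|` z by ba B.
by apply: bsup_le => x /Sy; ba B.
Qed.

Lemma bsup_top_neq0 S x : bsup S = \top -> x <> \bot ->
  exists2 s, S s & x `&` s <> \bot.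
Proof.
move=> S1 x0; apply: contrapT => nS; apply: x0; apply/eqP; rewrite -lex0.
rewrite -[x]meet1x -S1; apply: meet_bsup_le => s Ss; rewrite meetC.
by apply: contrapT => xs0; apply: nS; exists s => // e; apply: xs0; rewrite e.
Qed.

Section Subalgebra.
Context (C : set B) (sC : complete_subalgebra C).

Lemma subalg_compl x : C x -> C (~` x). Proof. exact: sC.1. Qed.
Lemma subalg_bsup S : S `<=` C -> C (bsup S). Proof. exact: sC.2. Qed.

Lemma subalg_bot : C \bot.
Proof.
have -> : \bot = bsup set0 :> B by apply/eqP; rewrite eq_sym -lex0; apply: bsup_le => x [].
by apply: subalg_bsup => x [].
Qed.

Lemma subalg_top : C \top.
Proof. by rewrite -compl0; apply: subalg_compl subalg_bot. Qed.

Lemma subalg_join x y : C x -> C y -> C (x `|` y).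
Proof.
move=> Cx Cy; have -> : x `|` y = bsup [set x; y].
  apply: le_anti; rewrite leUx !bsup_ub /=; [|by right|by left].
  by apply: bsup_le => z [->|->]; rewrite ?leUl ?leUr.
by apply: subalg_bsup => z [->|->].
Qed.

Lemma subalg_meet x y : C x -> C y -> C (x `&` y).
Proof.
move=> Cx Cy; have -> : x `&` y = ~` (~` x `|` ~` y) by ba B.
by apply/subalg_compl/subalg_join; exact: subalg_compl.
Qed.

Lemma subalg_binf S : S `<=` C -> C (binf S).
Proof.
move=> SC; have -> : binf S = ~` bsup [set ~` x | x in S].
  apply: le_anti; apply/andP; split.
    suff : bsup [set ~` x | x in S] <= ~` binf S by ba B.
    by apply: bsup_le => _ [x Sx <-]; move: (binf_lb Sx); ba B.
  apply: le_binf => x Sx.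
  by have : ~` x <= bsup [set ~` x | x in S] by [apply: bsup_ub; exists x]; ba B.
by apply/subalg_compl/subalg_bsup => _ [x /SC Cx <-]; exact: subalg_compl.
Qed.

End Subalgebra.

Section UpperProjection.
Context (A : set B) (sA : complete_subalgebra A).
Local Notation h := (upper_projection A).

Lemma up_in x : A (h x).
Proof. by apply: (subalg_binf sA) => a []. Qed.

Lemma le_up x : x <= h x.
Proof. by apply: le_binf => a []. Qed.

Lemma up_min a x : A a -> x <= a -> h x <= a.
Proof. by move=> Aa xa; apply: binf_lb. Qed.

Lemma up_mono x y : x <= y -> h x <= h y.
Proof. by move=> xy; apply: up_min (up_in y) (le_trans xy (le_up y)). Qed.

Lemma up_id a : A a -> h a = a.
Proof. by move=> Aa; apply: le_anti; rewrite le_up up_min. Qed.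

Lemma up_meet a x : A a -> h (a `&` x) = a `&` h x.
Proof.
move=> Aa; apply: le_anti; apply/andP; split.
  by apply: up_min; [apply: (subalg_meet sA) => //; exact: up_in | rewrite leI2 ?le_up].
suff : h x <= ~` a `|` h (a `&` x) by ba B.
apply: up_min; last by move: (le_up (a `&` x)); ba B.
by apply: (subalg_join sA); [exact: subalg_compl | exact: up_in].
Qed.

Lemma up_bot : h \bot = \bot.
Proof. by apply: up_id; exact: subalg_bot. Qed.

Lemma up_eq0 x : h x = \bot -> x = \bot.
Proof. by move=> hx; apply/eqP; rewrite -lex0 -hx le_up. Qed.

End UpperProjection.

(* Below [q], the algebra [C] is a copy of [A] below the upper projection of [q]. *)
Definition relative_atom A C q : Prop :=
  forall x, C x -> x <= q -> upper_projection A x `&` q = x.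

(** The elements that agree on [m] with some element of [A] form a complete subalgebra. It contains
    [A], and it contains [M] because [M] is an antichain, so it is everything. *)
Lemma generates_relative_atom A M m : complete_subalgebra A -> antichain M ->
  generates_over A M -> M m -> relative_atom A setT m.
Proof.
move=> sA [_ aM] gM Mm x _ xm.
pose D := [set y | exists2 a, A a & y `&` m = a `&` m].
have [a Aa xa] : D x.
  suff : smallest (complete_subalgebra (B:=B)) (A `|` M) `<=` D by rewrite gM; exact.
  apply: smallest_sub => [|y [Ay|My]]; last 2 first.
  - by exists y.
  - have [->|ym] := pselect (y = m); first by exists \top; [exact: subalg_top|ba B].
    by exists \bot; [exact: subalg_bot | rewrite meet0x aM].
  split => [y [a Aa ya]|S SD].
    by exists (~` a); [exact: subalg_compl | move: ya; ba B].
  (* All witnesses for all members of [S] are joined, so that none has to be chosen. *)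
  exists (bsup [set a | A a /\ exists2 y, S y & y `&` m = a `&` m]).
    by apply: subalg_bsup => // a [].
  apply: le_anti; rewrite !lexI !leIr !andbT; apply/andP; split; apply: meet_bsup_le.
    move=> y Sy; have [a Aa ya] := SD _ Sy; rewrite ya.
    by apply: le_trans (leIl _ _) _; apply: bsup_ub; split=> //; exists y.
  move=> a [Aa [y Sy <-]].
  by apply: le_trans (leIl _ _) _; apply: bsup_ub.
apply: le_anti; rewrite lexI le_up xm !andbT.
have : upper_projection A x <= a by apply: up_min => //; move: xa xm; ba B.
by move: xa; ba B.
Qed.

(** The complement of the join is added when it is nonzero. That at most one element is added
    matters for the cardinality count in (b). *)
Lemma antichain_maximize A M : antichain M -> generates_over A M ->
  exists M', [/\ antichain M', generates_over A M', bsup M' = \top,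
    M `<=` M' & M' `<=` M `|` [set ~` bsup M]].
Proof.
move=> [M0 aM] gM.
pose M' := [set x | M x \/ x = ~` bsup M /\ x <> \bot].
have dis x : M x -> x `&` ~` bsup M = \bot by move=> /bsup_ub; ba B.
exists M'; split => [||||x [|[]]]; [| | |by left|by left|by right].
- split => [[//|[]//]|x y [Mx|[-> _]] [My|[-> _]] xy //]; [exact: aM|exact: dis|].
  by rewrite meetC; exact: dis.
- rewrite /generates_over -subTset -gM; apply: sub_smallest2r.
    by split => [x|S] H X [sX sub]; [apply: subalg_compl => //; exact: H
      | apply: subalg_bsup => // x /H; exact].
  by move=> x [Ax|Mx]; [left|right; left].
- apply/eqP; rewrite -le1x -(joinxC (bsup M)) leUx; apply/andP; split.
    by apply: bsup_le => x Mx; apply: bsup_ub; left.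
  have [->|n0] := pselect (~` bsup M = \bot); first exact: le0x.
  by apply: bsup_ub; right.
Qed.

End Complete.

(** * Cardinal arithmetic *)

Section CardinalArithmetic.

Lemma card_le_rel T U (X : set T) (Y : set U) (R : T -> U -> Prop) :
  (forall x, X x -> exists2 y, Y y & R x y) ->
  (forall x x' y, X x -> X x' -> R x y -> R x' y -> x = x') -> X #<= Y.
Proof.
move=> RY Rinj; have [->|/set0P[x0 Xx0]] := eqVneq X set0; first exact: card_ge0.
have [y0 _ _] := RY _ Xx0.
have /choice[f fP] : forall x, exists y, X x -> Y y /\ R x y.
  move=> x; have [/RY[y Yy Rxy]|nX] := pselect (X x); first by exists y.
  by exists y0.
have : f @` X #= X.
  apply: inj_card_eq => x x' /set_mem Xx /set_mem Xx' ff'.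
  by apply: (Rinj x x' (f x)) => //; [apply fP | rewrite ff'; apply fP].
move=> /card_eqPle[_ h]; apply: card_le_trans h (subset_card_le _).
by move=> _ [x Xx <-]; apply fP.
Qed.

Lemma card_le_fun T U (X : set T) (Y : set U) (f : T -> U) :
  (forall x, X x -> Y (f x)) ->
  (forall x x', X x -> X x' -> f x = f x' -> x = x') -> X #<= Y.
Proof.
move=> fY finj; apply: (card_le_rel (R := fun x y => y = f x)).
  by move=> x Xx; exists (f x); [exact: fY|].
by move=> x x' y Xx Xx' -> /finj; exact.
Qed.

Lemma card_le_funP T U (X : set T) (Y : set U) (y0 : U) : X #<= Y ->
  exists f : T -> U, (forall x, X x -> Y (f x)) /\
    (forall x x', X x -> X x' -> f x = f x' -> x = x').
Proof.
move=> /card_leP[g].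
exists (fun x => if pselect (X x) is left Xx then val (g (SigSub (mem_set Xx))) else y0).
split => [x Xx|x x' Xx Xx'].
  by case: pselect => // Xx'; exact: set_valP.
case: pselect => // {}Xx; case: pselect => // {}Xx' /val_inj gg.
have /(congr1 val) // : SigSub (mem_set Xx) = SigSub (mem_set Xx') :> X.
by apply: (inj (f := g)) => //; rewrite inE.
Qed.

Lemma card_le_setTP T U : [set: T] #<= [set: U] <-> exists f : T -> U, injective f.
Proof.
split => [TU|[f finj]]; last by apply: (card_le_fun (f := f)) => // x x' _ _ /finj.
have [y0|nU] := pselect (exists y0 : U, True).
  by have [y _] := y0; have [f [_ finj]] := card_le_funP y TU; exists f => x x'; exact: finj.
have nT (x : T) : False.
  by case/card_leP: TU => g; apply: nU; exists (val (g (SigSub (mem_set (I : [set: T] x))))).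
by exists (fun x => False_rect U (nT x)) => x; case: (nT x).
Qed.

(** Zorn's lemma for graphs of partial injections: a maximal one exhausts [X] or [Y], since
    otherwise a pair of missed points could be added. *)
Lemma card_le_total T U (X : set T) (Y : set U) : X #<= Y \/ Y #<= X.
Proof.
pose P (R : set (T * U)) := [/\ forall p, R p -> X p.1 /\ Y p.2,
  forall x y y', R (x, y) -> R (x, y') -> y = y'
  & forall x x' y, R (x, y) -> R (x', y) -> x = x'].
have [F FP Ftot|R [[RXY Rfun Rinj] Rmax]] := @Zorn_bigcup _ P.
  split => [p [R /FP[h _ _] /h //]|x y y' [R FR Rp] [R' FR' Rp']|x x' y [R FR Rp] [R' FR' Rp']].
    by have [RR|RR] := Ftot _ _ FR FR'; [have [_ h _] := FP _ FR'|have [_ h _] := FP _ FR];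
      apply: h; first [exact: Rp|exact: RR Rp|exact: RR Rp'|exact: Rp'].
  by have [RR|RR] := Ftot _ _ FR FR'; [have [_ _ h] := FP _ FR'|have [_ _ h] := FP _ FR];
    apply: h; first [exact: Rp|exact: RR Rp|exact: RR Rp'|exact: Rp'].
have [XR|/existsNP[x /not_implyP[Xx nx]]] := pselect (forall x, X x -> exists y, R (x, y)).
  left; apply: (card_le_rel (R := fun x y => R (x, y))) => [x /XR[y Rxy]|x x' y _ _].
    by exists y => //; have [] := RXY _ Rxy.
  exact: Rinj.
have [YR|/existsNP[y /not_implyP[Yy ny]]] := pselect (forall y, Y y -> exists x, R (x, y)).
  right; apply: (card_le_rel (R := fun y x => R (x, y))) => [y /YR[x' Rxy]|y y' x' _ _].
    by exists x' => //; have [] := RXY _ Rxy.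
  exact: Rfun.
exfalso; apply: (Rmax (R `|` [set p | p.1 = x /\ p.2 = y])).
  split => [p|/(_ (x, y) (or_intror (conj erefl erefl))) Rxy]; first by left.
  by apply: nx; exists y.
split => [p [/RXY //|[-> ->]]//|a b b' [Rab|/= [-> ->]] [Rab'|/= [e ->]]//|
  a a' b [Rab|/= [-> ->]] [Rab'|/= [-> e]]//].
- exact: Rfun Rab Rab'.
- by subst a; case: nx; exists b.
- by case: nx; exists b'.
- exact: Rinj Rab Rab'.
- by subst b; case: ny; exists a.
- by case: ny; exists a'.
Qed.

(* Hessenberg: a maximal injection [D * D -> D], for an infinite subset [D], has
   [T #<= D]; otherwise [D] has a disjoint copy [i D] to which it extends. *)
Theorem infinite_card_square T : infinite_set [set: T] -> [set: T * T] #<= [set: T].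
Proof.
move=> /infiniteP /card_le_setTP[n ninj].
(* For the graph of an injection from D * D to D, the set D is recovered from the diagonal. *)
pose fld (R : set (T * T * T)) := [set x | exists y, R (x, x, y)].
pose good (R : set (T * T * T)) :=
  [/\ forall p y y', R (p, y) -> R (p, y') -> y = y',
      forall p p' y, R (p, y) -> R (p', y) -> p = p',
      forall x x', fld R x -> fld R x' -> exists y, R (x, x', y),
      forall x x' y, R (x, x', y) -> [/\ fld R x, fld R x' & fld R y]
    & forall k, fld R (n k)].
have [F FP Ftot|R [[R0|gR] Rmax]] := @Zorn_bigcup _ [set R | R = set0 \/ good R].
- have [[R FR gR]|nF] := pselect (exists2 R, F R & good R); last first.
    left; apply/seteqP; split => // p [R FR Rp]; have [R0|gR] := FP _ FR.
      by rewrite R0 in Rp.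
    by case: nF; exists R.
  right; have gF S p : F S -> S p -> good S.
    by move=> FS Sp; have [S0|//] := FP _ FS; rewrite S0 in Sp.
  have fldF S x : F S -> fld S x -> fld (\bigcup_(X in F) X) x.
    by move=> FS [y Sy]; exists y; exists S.
  have common p q S S' : F S -> F S' -> S p -> S' q -> exists S'', [/\ F S'', S'' p & S'' q].
    move=> FS FS' Sp Sq; have [SS|SS] := Ftot _ _ FS FS'.
      by exists S'; split => //; exact: SS.
    by exists S; split => //; exact: SS.
  split => [p y y' [S FS Sp] [S' FS' Sp']|p p' y [S FS Sp] [S' FS' Sp']|
            x x' [y [S FS Sp]] [y' [S' FS' Sp']]|x x' y [S FS Sp]|k].
  + have [S'' [FS'' Sq Sq']] := common _ _ _ _ FS FS' Sp Sp'.
    by have [h _ _ _ _] := gF _ _ FS'' Sq; exact: h Sq Sq'.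
  + have [S'' [FS'' Sq Sq']] := common _ _ _ _ FS FS' Sp Sp'.
    by have [_ h _ _ _] := gF _ _ FS'' Sq; exact: h Sq Sq'.
  + have [S'' [FS'' Sq Sq']] := common _ _ _ _ FS FS' Sp Sp'.
    have [_ _ h _ _] := gF _ _ FS'' Sq.
    have [|y'' Sy] := h x x' (ex_intro _ _ Sq); first by exists y'.
    by exists y''; exists S''.
  + have [_ _ _ h _] := gF _ _ FS Sp.
    by have [fx fx' fy] := h _ _ _ Sp; split; apply: fldF FS _.
  + by have [_ _ _ _ h] := gR; apply: fldF FR _.
- have [/card_eqPle[/card_le_setTP[c cinj] _]] := card_nat2.
  pose S := [set p | exists i j, p = (n i, n j, n (c (i, j)))] : set (T * T * T).
  exfalso; apply: (Rmax S).
    rewrite R0; split => // /(_ (n 0%N, n 0%N, n (c (0%N, 0%N)))); apply.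
    by exists 0%N, 0%N.
  have fS k : fld S (n k) by exists (n (c (k, k))); exists k, k.
  right; split => [p y y' [i [j [-> ->]]] [i' [j' [/ninj -> /ninj -> ->]]] //|
    p p' y [i [j [-> ->]]] [i' [j' [-> /ninj/cinj[-> ->]]]] //|
    x x' [y [i [j [-> _ _]]]] [y' [i' [j' [-> _ _]]]]|
    x x' y [i [j [-> -> ->]]] //|//].
  by exists (n (c (i, i'))); exists i, i'.
case: gR => Rfun Rinj Rtot Rfld Rn.
pose D := fld R.
have /choice[f fP] : forall p, exists y, D p.1 -> D p.2 -> R (p, y).
  move=> [x x']; have [[Dx Dx']|nD] := pselect (D x /\ D x').
    by have [y Ry] := Rtot _ _ Dx Dx'; exists y.
  by exists x => Dx Dx'; case: nD.
have fD x x' : D x -> D x' -> D (f (x, x')).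
  by move=> Dx Dx'; have [] := Rfld _ _ _ (fP (x, x') Dx Dx').
have finj x y x' y' : D x -> D y -> D x' -> D y' -> f (x, y) = f (x', y') -> x = x' /\ y = y'.
  move=> Dx Dy Dx' Dy' e.
  by have [] : (x, y) = (x', y') by apply: (Rinj _ _ _ (fP (x, y) Dx Dy)); rewrite e; exact: fP.
have [TD|/(card_le_funP (n 0%N))[i [iD iinj]]] := card_le_total (~` D) D.
  have [u [uD uinj]] := card_le_funP (n 0%N) TD.
  pose v x := if pselect (D x) is left _ then f (n 0%N, x) else f (n 1%N, u x).
  have vD x : D (v x) by rewrite /v; case: pselect => Dx; [exact: fD (Rn _) Dx | exact: fD (Rn _) (uD _ Dx)].
  have vinj : injective v.
    move=> x x'; rewrite /v; case: pselect => Dx; case: pselect => Dx' e.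
    - by have [] := finj _ _ _ _ (Rn _) Dx (Rn _) Dx' e.
    - by have [/ninj] := finj _ _ _ _ (Rn _) Dx (Rn _) (uD _ Dx') e.
    - by have [/ninj] := finj _ _ _ _ (Rn _) (uD _ Dx) (Rn _) Dx' e.
    - by have [_ /uinj] := finj _ _ _ _ (Rn _) (uD _ Dx) (Rn _) (uD _ Dx') e; exact.
  apply/card_le_setTP; exists (fun p => f (v p.1, v p.2)) => -[x y] [x' y'] /= e.
  by have [/vinj -> /vinj ->] := finj _ _ _ _ (vD _) (vD _) (vD _) (vD _) e.
pose E x := exists2 z, D z & x = i z.
have DE x : D x -> E x -> False by move=> Dx [z /iD h e]; rewrite e in Dx.
have /choice[j jP] : forall x, exists z, (D x -> z = x) /\ (E x -> D z /\ x = i z).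
  move=> x; have [Dx|nD] := pselect (D x).
    by exists x; split => // /(DE _ Dx).
  have [[z Dz xz]|nE] := pselect (E x); first by exists z; split.
  by exists x; split.
pose DuE x := D x \/ E x.
have jD x : DuE x -> D (j x) by move=> [Dx|/(jP _).2[]//]; rewrite (jP _).1.
(* The new pairs fall into three blocks: D * E, E * D and E * E. The tag [t] keeps their codes apart
   once [j] has moved all coordinates into [D]. *)
pose t x y : nat := if `[< D x >] then 0 else if `[< D y >] then 1 else 2.
pose g x y := i (f (f (n (t x y), j x), j y)).
have jinj x x' : `[< D x >] = `[< D x' >] -> DuE x -> DuE x' -> j x = j x' -> x = x'.
  move=> dd [Dx|Ex].
    have Dx' : D x' by apply/asboolP; rewrite -dd; apply/asboolP.
    by move=> _; rewrite !(jP _).1.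
  move=> [Dx'|Ex']; first by have := asboolT Dx'; rewrite -dd => /asboolP/DE/(_ Ex).
  by have [_ {2}->] := (jP _).2 Ex; have [_ {2}->] := (jP _).2 Ex' => ->.
pose N p := [/\ DuE p.1, DuE p.2 & ~ (D p.1 /\ D p.2)].
have gE p : N p -> E (g p.1 p.2).
  move=> [Ep Eq _]; exists (f (f (n (t p.1 p.2), j p.1), j p.2)) => //.
  exact: fD _ _ (fD _ _ (Rn _) (jD _ Ep)) (jD _ Eq).
have ginj p p' : N p -> N p' -> g p.1 p.2 = g p'.1 p'.2 -> p = p'.
  case: p p' => [x y] [x' y'] [/= Ex Ey nD] [/= Ex' Ey' nD'].
  have F1 := fD _ _ (Rn (t x y)) (jD _ Ex); have F2 := fD _ _ (Rn (t x' y')) (jD _ Ex').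
  move=> /(iinj _ _ (fD _ _ F1 (jD _ Ey)) (fD _ _ F2 (jD _ Ey'))).
  move=> /(finj _ _ _ _ F1 (jD _ Ey) F2 (jD _ Ey'))[].
  move=> /(finj _ _ _ _ (Rn _) (jD _ Ex) (Rn _) (jD _ Ex'))[/ninj tt jx jy].
  have [dx dy] : `[< D x >] = `[< D x' >] /\ `[< D y >] = `[< D y' >].
    have nb a b : ~ (D a /\ D b) -> ~~ (`[< D a >] && `[< D b >]).
      by move=> nab; apply/negP => /andP[/asboolP Da /asboolP Db]; apply: nab.
    move: tt (nb _ _ nD) (nb _ _ nD'); rewrite /t.
    by case: `[< D x >]; case: `[< D y >]; case: `[< D x' >]; case: `[< D y' >].
  by rewrite (jinj x x') // (jinj y y').
pose R' := R `|` [set q | N q.1 /\ q.2 = g q.1.1 q.1.2].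
have RN p y : R (p, y) -> N p -> False.
  by case: p => x x' /Rfld[Dx Dx' _] [_ _]; apply.
have fldR' x : fld R' x <-> DuE x.
  split => [[y [Rxy|[[/= h _ _] _]]]//|[[y Rxy]|Ex]]; [|by exists y; left|].
    by left; exists y.
  exists (g x x); right; split => //; split => /=; [by right|by right|].
  by move=> [/DE/(_ Ex)].
exfalso; apply: (Rmax R').
  split => [p|RR]; first by left.
  have Ei : E (i (n 0%N)) by exists (n 0%N) => //; exact: Rn.
  have Ni : N (i (n 0%N), i (n 0%N)) by split => /=; [by right|by right|move=> [/DE/(_ Ei)]].
  by apply: (RN _ (g (i (n 0%N)) (i (n 0%N))) _ Ni); apply: RR; right.
right; split => [p y y' [Rp|[/= Np ->]] [Rp'|[/= Np' ->]] //|p p' y [Rp|[/= Np ->]] [Rp'|[/= Np' e]]|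
  x x' /fldR' Fx /fldR' Fx'|x x' y [Rp|[/= Np ->]]|k].
- exact: Rfun Rp Rp'.
- by case: (RN _ _ Rp Np').
- by case: (RN _ _ Rp' Np).
- exact: Rinj Rp Rp'.
- case: (p) Rp => a b /Rfld[_ _ Dy].
  by exfalso; apply: (DE y) => //; rewrite e; exact: gE.
- case: (p') Rp' => a b /Rfld[_ _ Dy].
  by exfalso; apply: (DE _ Dy); exact: gE.
- exact: ginj.
- have [[Dx Dx']|nD] := pselect (D x /\ D x').
    by have [y Ry] := Rtot _ _ Dx Dx'; exists y; left.
  by exists (g x x'); right.
- by have [Dx Dx' Dy] := Rfld _ _ _ Rp; split; apply/fldR'; left.
- by have [Ex Ex' _] := Np; split; apply/fldR' => //; right; exact: (gE (x, x')).
- by apply/fldR'; left; exact: Rn.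
Qed.

End CardinalArithmetic.

Lemma infinite_card_seq T : infinite_set [set: T] -> [set: seq T] #<= [set: T].
Proof.
move=> iT; have /card_le_setTP[c cinj] := infinite_card_square iT.
have /infiniteP/card_le_setTP[n ninj] := iT.
(* The tags [n 0] and [n 1] separate the code of the empty sequence from the others. *)
pose code := foldr (fun x a => c (n 1%N, c (x, a))) (c (n 0%N, n 0%N)).
apply/card_le_setTP; exists code; elim=> [|x s IH] [|y s'] //= /cinj.
- by case=> /ninj.
- by case=> /ninj.
- by case=> /cinj[-> /IH ->].
Qed.

Lemma card_lt_le T U V (X : set T) (Y : set U) (Z : set V) :
  X #<= Y -> card_lt Y Z -> card_lt X Z.
Proof.
move=> XY [YZ ZY]; split; first exact: card_le_trans YZ.
by move=> ZX; apply: ZY; exact: card_le_trans XY.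
Qed.

Lemma countable_card_lt T U (X : set T) (Z : set U) :
  ~ countable Z -> countable X -> card_lt X Z.
Proof.
move=> nZ cX; split; last by move=> ZX; apply: nZ; exact: card_le_trans cX.
apply: card_le_trans cX _; apply/infiniteP => fZ; exact/nZ/finite_set_countable.
Qed.

Lemma card_lt_nat_prod T U (Z : set U) :
  ~ countable Z -> card_lt [set: T] Z -> card_lt [set: nat * T] Z.
Proof.
move=> nZ TZ; have [fT|iT] := pselect (finite_set [set: T]).
  apply: countable_card_lt => //.
  have /card_le_setTP[f finj] := finite_set_countable fT.
  apply: card_le_trans (_ : _ #<= [set: nat * nat]) _; last by have/card_eqPle[] := card_nat2.
  by apply/card_le_setTP; exists (fun p => (p.1, f p.2)) => -[a b] [a' b'] [-> /finj ->].
apply: card_lt_le TZ; apply: card_le_trans (infinite_card_square iT).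
have /infiniteP/card_le_setTP[n ninj] := iT.
by apply/card_le_setTP; exists (fun p => (n p.1, p.2)) => -[a b] [a' b'] [/ninj -> ->].
Qed.

(** * Regular cardinals and ranked trees *)

Section Regular.
Context (dK : Order.disp_t) (K : orderType dK) (rK : regular_uncountable K).

Lemma ord_min (P : set K) : P !=set0 -> exists2 a, P a & forall b, P b -> a <= b.
Proof.
case: rK => wf _ _ _ [a Pa]; apply: contrapT => nP; move: Pa.
elim/(well_founded_ind wf): a => a IH Pa; apply: nP; exists a => // b Pb.
by rewrite leNgt; apply/negP => /IH/(_ Pb).
Qed.

Lemma small_bounded (S : set K) : card_lt S [set: K] -> exists a, forall s, S s -> s < a.
Proof.
case: rK => _ _ _ reg [_ nS]; apply: contrapT => nb; apply: nS; apply: reg => a.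
apply: contrapT => na; apply: nb; exists a => s Ss; rewrite ltNge; apply/negP => as_.
by apply: na; exists s.
Qed.

Lemma small_image_bounded T (X : set T) (f : T -> K) : card_lt X [set: K] ->
  exists a, forall x, X x -> f x < a.
Proof.
move=> /(card_lt_le (card_image_le f X))/small_bounded[a aP].
by exists a => x Xx; apply: aP; exists x.
Qed.

Lemma countable_small T (X : set T) : countable X -> card_lt X [set: K].
Proof. by case: rK => _ _ uK _; exact: countable_card_lt. Qed.

(** [g a] is the least element of [X] above all earlier values, which are bounded by regularity
    because the segment below [a] is small. As [a <= g a], each [x] in [X] is the value at the least
    [a] with [x <= g a]. *)
Lemma unbounded_enum (X : set K) : (forall a, exists2 x, X x & a <= x) ->
  exists g : K -> K, [/\ forall a, X (g a), forall a b, a < b -> g a < g b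
    & forall x, X x -> exists a, g a = x].
Proof.
case: (rK) => wf seg _ _ uX.
have [a0 _] := small_bounded (countable_small (countable0 K)).
have /choice[mn mnP] : forall P : set K, exists a, P !=set0 -> P a /\ forall b, P b -> a <= b.
  move=> P; have [/ord_min[a Pa aP]|nP] := pselect (P !=set0); first by exists a.
  by exists a0.
pose g := Fix wf (fun=> K) (fun a r => mn [set x | X x /\ forall b (ba : b < a), r b ba < x]).
have gE a : g a = mn [set x | X x /\ forall b, b < a -> g b < x].
  rewrite {1}/g Fix_eq // => x r r' rr'; congr mn; apply/funext => y.
  by congr (_ /\ _); apply/propext; split=> h b ba; rewrite ?rr' ?h // -rr'.
have gP a : (X (g a) /\ forall b, b < a -> g b < g a) /\
    forall x, X x -> (forall b, b < a -> g b < x) -> g a <= x.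
  rewrite (gE a); have [|[h1 h2] h3] := mnP [set x | X x /\ forall b, b < a -> g b < x].
    have [c cP] := small_image_bounded g (seg a).
    by have [x Xx cx] := uX c; exists x; split => // b /cP/lt_le_trans; exact.
  by split => // x Xx xb; apply: h3.
have gmono a b : a < b -> g a < g b by have [[_ h] _] := gP b; exact: h.
have gge a : a <= g a.
  elim/(well_founded_ind wf): a => a IH; rewrite leNgt; apply/negP => ga.
  by have := IH _ ga; rewrite leNgt gmono.
exists g; split => // [a|x Xx]; first by have [[]] := gP a.
have [a xa amin] := ord_min (ex_intro (fun a => x <= g a) x (gge x)).
exists a; apply: le_anti; rewrite xa andbT.
have [_ h] := gP a; apply: h => // b ba; rewrite ltNge; apply/negP => /amin.
by rewrite leNgt ba.
Qed.

Section Ranked.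
Context (dP : Order.disp_t) (P : porderType dP).
Implicit Types (T : set P) (s t u : P) (a b : K) (rk : P -> K).

(** One height function for the whole tree replaces the separate order isomorphisms hidden in
    [tree_level]; the last clause says that no height is skipped on the way to [t]. *)
Definition ranked T rk : Prop :=
  [/\ forall t s u, T t -> tree_preds T t s -> tree_preds T t u -> s >=< u,
      forall s t, T s -> T t -> s < t -> rk t < rk s
    & forall t b, T t -> b < rk t -> exists2 s, tree_preds T t s & rk s = b].

Lemma ranked_is_tree T rk : ranked T rk -> is_tree T.
Proof.
case=> cmp mono _ t Tt S St [s Ss].
have [_ [m Sm <-] mmin] := ord_min (ex_intro [set rk x | x in S] _ (ex_intro2 _ _ s Ss erefl)).
exists m => // u Su; have [Tm tm] := St _ Sm; have [Tu tu] := St _ Su.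
have [um|] := boolP (u <= m) => // num.
have mu : m < u.
  have := cmp _ _ _ Tt (St _ Sm) (St _ Su); rewrite comparable_sym /Order.comparable (negbTE num) /=.
  move=> mu; rewrite lt_neqAle mu andbT; apply: contraNneq num => ->; exact: lexx.
by have := mono _ _ Tm Tu mu; rewrite ltNge mmin //; exists u.
Qed.

Lemma ranked_level T rk t : ranked T rk -> T t -> tree_level T (rk t) t.
Proof.
case=> cmp mono surj Tt; split => //; exists rk.
have rk_lt s u : tree_preds T t s -> tree_preds T t u -> (rk s < rk u) = (u < s).
  move=> Ps Pu; have [Ts ts] := Ps; have [Tu tu] := Pu.
  have [us|nus] := boolP (u < s); first exact: mono.
  apply/negP => su; have := cmp _ _ _ Tt Ps Pu.
  rewrite /Order.comparable => /orP[|]; last first.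
    rewrite le_eqVlt (negbTE nus) orbF => /eqP us.
    by rewrite us ltxx in su.
  rewrite le_eqVlt => /orP[/eqP e|/(mono _ _ Ts Tu)]; first by rewrite e ltxx in su.
  by rewrite ltNge (ltW su).
split => //; split => [s [Ts ts]|s u /set_mem Ps /set_mem Pu e|b /= bt].
- exact: mono.
- have [Ts _] := Ps; have [Tu _] := Pu.
  have := cmp _ _ _ Tt Ps Pu; rewrite /Order.comparable !le_eqVlt -!rk_lt // e ltxx !orbF.
  by case/orP => /eqP.
- by have [s Ps <-] := surj _ _ Tt bt; exists s.
Qed.

Lemma tree_level_uniq T a b t : tree_level T a t -> tree_level T b t -> a = b.
Proof.
case: (rK) => wf _ _ _ [_ [f [[fun_f inj_f surj_f] lt_f]]] [_ [g [[fun_g inj_g surj_g] lt_g]]].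
have fg c s : tree_preds T t s -> f s = c -> g s = c.
  elim/(well_founded_ind wf): c s => c IH s Ps fs.
  have [gc|cg|//] := ltgtP (g s) c.
    have [u Pu fu] : (f @` tree_preds T t) (g s).
      by apply: surj_f; rewrite /= (lt_trans gc) // -fs; exact: fun_f.
    have gu := IH _ gc u Pu fu.
    suff us : u = s by rewrite us fs in fu; rewrite fu ltxx in gc.
    by apply: inj_g; rewrite ?inE.
  have [u Pu gu] : (g @` tree_preds T t) c.
    by apply: surj_g; rewrite /= (lt_trans cg) //; exact: fun_g.
  have su : s < u by rewrite -lt_g // gu.
  have fuc : f u < c by rewrite -fs lt_f.
  have := IH _ fuc u Pu erefl; rewrite gu => cu.
  by rewrite -cu ltxx in fuc.
have gf s : tree_preds T t s -> g s = f s by move=> Ps; exact: fg Ps _.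
have [ab|ba|//] := ltgtP a b.
  have [s Ps gs] : (g @` tree_preds T t) a by apply: surj_g.
  by have := fun_f _ Ps; rewrite /= -gf // gs ltxx.
have [s Ps fs] : (f @` tree_preds T t) b by apply: surj_f.
by have := fun_g _ Ps; rewrite /= gf // fs ltxx.
Qed.

(** Levels become values of [rk], since [tree_level_uniq] allows a node only one level. *)
Lemma ranked_levelE T rk a t : ranked T rk -> tree_level T a t <-> T t /\ rk t = a.
Proof.
move=> rT; split => [lt|[Tt <-]]; last exact: ranked_level.
have Tt : T t by case: lt.
by split => //; apply: tree_level_uniq lt; exact: ranked_level.
Qed.

(** The isomorphism attached to [t] restricts to the predecessors of each [s] above [t], so by
    uniqueness of levels it computes the rank of [s]. *)
Lemma tree_ranked T : is_tree T -> (forall t, T t -> exists a, tree_level T a t) ->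
  exists rk, ranked T rk.
Proof.
move=> tT hT; have [a0 _] := small_bounded (countable_small (countable0 K)).
have /choice[rk rkP] : forall t, exists a, T t -> tree_level T a t.
  by move=> t; have [/hT[a h]|n] := pselect (T t); [exists a|exists a0].
exists rk.
have rkE s t (f : P -> K) : T t -> set_bij (tree_preds T t) [set b | b < rk t] f ->
    (forall s u, tree_preds T t s -> tree_preds T t u -> (f s < f u) = (u < s)) ->
    tree_preds T t s -> rk s = f s.
  move=> Tt [fun_f inj_f surj_f] lt_f Ps; have [Ts ts] := Ps.
  apply: (tree_level_uniq (rkP _ Ts)); split => //; exists f.
  have sub u : tree_preds T s u -> tree_preds T t u.
    by move=> [Tu su]; split => //; exact: lt_trans su.
  split; last by move=> v u /sub Pv /sub Pu; exact: lt_f.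
  split => [u Pu|u v /set_mem/sub Pu /set_mem/sub Pv|b /= bs].
  - by rewrite /= lt_f; [case: Pu|exact: sub|].
  - by apply: inj_f; rewrite inE.
  - have [u Pu fu] : (f @` tree_preds T t) b.
      by apply: surj_f; rewrite /= (lt_trans bs) //; exact: fun_f.
    by exists u => //; split; [case: Pu | rewrite -lt_f // fu].
split => [t s u Tt Ps Pu|s t Ts Tt st|t b Tt bt].
- have su_t : [set s; u] `<=` tree_preds T t by move=> z [->|->].
  have [z [->|->] zu] := tT t Tt _ su_t (ex_intro _ s (or_introl erefl)).
    by apply/orP; right; apply: zu; right.
  by apply/orP; left; apply: zu; left.
- have [_ [f [bij lt_f]]] := rkP _ Ts.
  have [fun_f _ _] := bij.
  by rewrite (rkE t s f) //; apply: fun_f.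
- have [_ [f [bij lt_f]]] := rkP _ Tt.
  have [_ _ surj_f] := bij.
  have [s Ps fs] : (f @` tree_preds T t) b by apply: surj_f.
  by exists s => //; rewrite (rkE s t f).
Qed.

End Ranked.
End Regular.

(** * Souslinizations *)

Section SouslinTree.
Context (dK : Order.disp_t) (K : orderType dK) (rK : regular_uncountable K).
Context (d : Order.disp_t) (B : ctbDistrLatticeType d) (cB : complete_algebra B).
Context (ccB : kappa_cc B K).

Lemma comparable_meet_neq0 (x y : B) : x <> \bot -> y <> \bot -> x >=< y -> x `&` y <> \bot.
Proof. by move=> x0 y0 /orP[/meet_l|/meet_r] ->. Qed.

Lemma souslinization_ranked C T : souslinization K C T ->
  exists rk : B -> K, ranked T rk.
Proof. by case=> _ _ _ [[tT [hT _] _ _] _] _; exact: (tree_ranked rK). Qed.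

Lemma souslinization_top_neq0 (C T : set B) : souslinization K C T -> (\top : B) <> \bot.
Proof.
case=> _ Tbot _ [_ [[r Tr _] _ _ _]] _ e; apply: Tbot.
have : r <= \bot by rewrite -e lex1.
by rewrite lex0 => /eqP <-.
Qed.

Context (T : set B) (rk : B -> K) (sT : souslinization K setT T) (rT : ranked T rk).
Implicit Types (s t u x y : B) (a b c : K).

Lemma node_neq0 t : T t -> t <> \bot.
Proof. by case: sT => _ T0 _ _ _ Tt t0; rewrite t0 in Tt. Qed.

Lemma node_below x : x <> \bot -> exists2 t, T t & t <= x.
Proof. by case: sT => _ _ + _ _ => /(_ x I). Qed.

(** By density some node lies below the meet; [s] and [t] are among its predecessors or equal to
    it. *)
Lemma node_comparable s t : T s -> T t -> s `&` t <> \bot -> s >=< t.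
Proof.
move=> Ts Tt /node_below[u Tu]; rewrite lexI => /andP[us ut].
have [<-|nus] := eqVneq u s; first by rewrite /Order.comparable ut.
have [<-|nut] := eqVneq u t; first by rewrite /Order.comparable us orbT.
by case: rT => cmp _ _; apply: (cmp u) => //; split; rewrite // lt_neqAle ?nus ?nut.
Qed.

Lemma node_le s t : T s -> T t -> s `&` t <> \bot -> rk t <= rk s -> s <= t.
Proof.
move=> Ts Tt st ts; case/orP: (node_comparable Ts Tt st) => //.
rewrite le_eqVlt => /orP[/eqP-> //|lts]; case: rT => _ mono _.
by have := mono _ _ Tt Ts lts; rewrite ltNge ts.
Qed.

Lemma node_above t b : T t -> b <= rk t -> exists s, [/\ T s, t <= s & rk s = b].
Proof.
move=> Tt; rewrite le_eqVlt => /orP[/eqP->|]; first by exists t.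
by case: rT => _ _ h /(h _ _ Tt)[s [Ts ts] rs]; exists s; split => //; exact: ltW.
Qed.

Lemma node_extend t b : T t -> rk t <= b -> exists s, [/\ T s, s <= t & rk s = b].
Proof.
move=> Tt; rewrite le_eqVlt => /orP[/eqP<-|tb]; first by exists t.
case: sT => _ _ _ [_ [_ _ ext _]] _.
have [s + st] := ext _ _ t (ranked_level rT Tt) tb.
by move=> /(ranked_levelE rK)-/(_ _ rT)[Ts rs]; exists s; split => //; exact: ltW.
Qed.

Lemma node_deep x b : x <> \bot -> exists t, [/\ T t, t <= x & b <= rk t].
Proof.
move=> /node_below[t Tt tx]; have [tb|/ltW bt] := leP (rk t) b; last by exists t.
have [s [Ts st rs]] := node_extend Tt tb.
by exists s; rewrite rs; split => //; exact: le_trans tx.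
Qed.

Lemma node_split x b : x <> \bot ->
  exists c t1 t2, [/\ b < c, T t1 /\ rk t1 = c, T t2 /\ rk t2 = c, t1 <= x /\ t2 <= x & t1 <> t2].
Proof.
move=> /(node_deep b)[t [Tt tx bt]].
case: (sT) => _ _ _ [_ [_ /(_ t Tt)[s1 [s2 [[Ts1 s1t i1] [Ts2 s2t i2] ns]]] _ _]] _.
case: (rT) => _ mono _.
have [b1 b2] := (le_lt_trans bt (mono _ _ Ts1 Tt s1t), le_lt_trans bt (mono _ _ Ts2 Tt s2t)).
(* Extending both successors to the larger of their ranks puts them on a common level without
   comparing the ranks. *)
have [m1 m2] : rk s1 <= Order.max (rk s1) (rk s2) /\ rk s2 <= Order.max (rk s1) (rk s2).
  by rewrite !le_max !lexx orbT.
have [t1 [Tt1 t1s rt1]] := node_extend Ts1 m1.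
have [t2 [Tt2 t2s rt2]] := node_extend Ts2 m2.
exists (Order.max (rk s1) (rk s2)), t1, t2; split => //.
- by rewrite lt_max b1.
- by split; [apply: le_trans t1s (le_trans (ltW s1t) tx)|apply: le_trans t2s (le_trans (ltW s2t) tx)].
move=> e; have /(node_comparable Ts1 Ts2) : s1 `&` s2 <> \bot.
  move=> s0; apply: (node_neq0 Tt1); apply/eqP; rewrite -lex0 -s0 lexI t1s.
  by rewrite e.
have lt_ne x' y' : x' <> y' -> x' <= y' -> x' < y' :> B.
  by move=> /eqP n l; rewrite lt_neqAle n.
case/orP => [/(lt_ne _ _ ns) l|/(lt_ne _ _ (nesym ns)) l].
  by apply: i1; exists s2.
by apply: i2; exists s1.
Qed.

(** For a fixed [x], the maximal nodes that decide [x] form an antichain [W], so their ranks are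
    bounded. Every node of larger rank lies below a member of [W] and inherits its decision. The
    bounds for all [x] in [X] are again bounded, by regularity. *)
Lemma node_decides (X : set B) : card_lt X [set: K] ->
  exists c, forall x t, X x -> T t -> c <= rk t -> t <= x \/ t `&` x = \bot.
Proof.
move=> smallX; pose D x t := t <= x \/ t `&` x = \bot.
have D_le x s t : s <= t -> D x t -> D x s.
  by move=> st [tx|tx]; [left; exact: le_trans tx|right; move: st tx; ba B].
suff /choice[c cP] : forall x, exists c, forall t, T t -> c <= rk t -> D x t.
  have [b bP] := small_image_bounded rK c smallX.
  by exists b => x t /bP cb Tt bt; apply: cP => //; exact: le_trans (ltW cb) bt.
move=> x; pose W := [set t | [/\ T t, D x t & forall s, T s -> t < s -> ~ D x s]].
have aW : antichain W.
  split => [[/node_neq0//]|s t [Ts Ds Ws] [Tt Dt Wt] ns].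
  apply: contrapT => /(node_comparable Ts Tt)/orP[]; rewrite le_eqVlt => /orP[/eqP e|l].
  - exact: ns.
  - exact: Ws l Dt.
  - exact/ns/esym.
  - exact: Wt l Ds.
have [c cP] := small_image_bounded rK rk (ccB aW).
exists c => t Tt ct.
have [u [Tu ut Du]] : exists u, [/\ T u, u <= t & D x u].
  have [tx0|/node_below[u Tu]] := pselect (t `&` x = \bot); first by exists t; split => //; right.
  by rewrite lexI => /andP[ut ux]; exists u; split => //; left.
have [_ [s [Ts us Ds] <-] smin] :=
  ord_min rK (ex_intro [set rk s | s in [set s | [/\ T s, u <= s & D x s]]] _
    (ex_intro2 _ _ u (And3 Tu (lexx u) Du) erefl)).
have Ws : W s.
  split => // v Tv sv Dv; have : rk s <= rk v.
    by apply: smin; exists v => //; split => //; exact: le_trans us (ltW sv).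
  by case: rT => _ mono _; rewrite leNgt mono.
apply: D_le Ds; apply: node_le => //; last exact: le_trans (ltW (cP _ Ws)) ct.
move=> ts0; apply: (node_neq0 Tu); apply/eqP; rewrite -lex0 -ts0.
by rewrite lexI ut.
Qed.

End SouslinTree.

(** * Copying a Souslinization through relative atoms *)

Section CopiedTree.
Context (dK : Order.disp_t) (K : orderType dK) (rK : regular_uncountable K).
Context (d : Order.disp_t) (B : ctbDistrLatticeType d) (cB : complete_algebra B).
Context (ccB : kappa_cc B K).
Context (T : set B) (rk : B -> K) (sT : souslinization K setT T) (rT : ranked T rk).
Context (A : set B) (sA : complete_subalgebra A).
Local Notation h := (upper_projection A).
Context (p : B) (pA : relative_atom A setT p) (hp : h p = \top).
Context (C : set B) (sC : complete_subalgebra C) (AC : A `<=` C).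
Context (Q : set B) (QC : Q `<=` C) (aQ : antichain Q) (Q1 : bsup Q = \top).
Context (atQ : forall q, Q q -> relative_atom A C q).
Context (c : K) (c_pos : exists z, z < c).
Context (c_decides : forall q t, Q q -> T t -> c <= rk t ->
  t <= p `&` h q \/ t `&` (p `&` h q) = \bot).
Context (q0 t1 t2 : B) (Qq0 : Q q0).
Context (Tt1 : T t1 /\ rk t1 = c) (Tt2 : T t2 /\ rk t2 = c) (nt : t1 <> t2).
Context (t1p : t1 <= p `&` h q0) (t2p : t2 <= p `&` h q0).
Implicit Types (q s t u x y : B) (a b : K).

(** Only the members of [Q] are disjoint, not their projections: one node may belong to the branches
    of several [q] and is then copied below each of them. *)
Definition branch q t : Prop := [/\ Q q, T t, c <= rk t & t <= p `&` h q].

(* [x |-> h x & q] is an isomorphism from the principal ideal of [p & h q] in [B]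
   to that of [q] in [C]. *)
Definition copied_tree : set B :=
  [set y | y = \top \/ exists q t, branch q t /\ y = h t `&` q].

Let up_copy q x : x <= p `&` h q -> h (h x `&` q) = h x.
Proof.
rewrite lexI => /andP[_ xq]; rewrite up_meet //; last exact: up_in.
by apply/meet_l; rewrite -(up_id cB (up_in cB sA q)); exact: up_mono.
Qed.

(** The inverse of the copying map sends [y] to the meet of [p] and [h y]. *)
Let copyK q x : x <= p `&` h q -> p `&` h (h x `&` q) = x.
Proof.
by move=> xpq; rewrite up_copy // meetC pA //; move: xpq; rewrite lexI => /andP[].
Qed.

Let copy_le q x y : x <= p `&` h q -> y <= p `&` h q ->
  (h x `&` q <= h y `&` q) = (x <= y).
Proof.
move=> xq yq; apply/idP/idP => xy; last by apply: leI2 => //; exact: up_mono.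
by rewrite -(copyK xq) -(copyK yq) leI2 // up_mono.
Qed.

Let copy_lt q x y : x <= p `&` h q -> y <= p `&` h q ->
  (h x `&` q < h y `&` q) = (x < y).
Proof. by move=> xq yq; rewrite !lt_leAnge !copy_le. Qed.

Let copy_neq0 q t : branch q t -> h t `&` q <> \bot.
Proof.
move=> [_ Tt _ tq] e; apply: (node_neq0 sT Tt).
by rewrite -(copyK tq) e (up_bot cB sA) meetx0.
Qed.

Let copy_uniq q t q' t' x : branch q t -> branch q' t' -> x <> \bot ->
  x <= h t `&` q -> x <= h t' `&` q' -> q = q'.
Proof.
move=> [Qq _ _ _] [Qq' _ _ _] x0 xq xq'; apply: contrapT => nq; apply: x0.
by move: (aQ.2 _ _ Qq Qq' nq) xq xq'; ba B.
Qed.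

(** A copy equal to [\top] would force [t = p]. Then [t1] and [t2], which lie below [p] on a level
    not exceeding that of [t], would both be equal to [t]. *)
Let copy_lt_top q t : branch q t -> h t `&` q < \top.
Proof.
move=> [Qq Tt ct tq]; rewrite lt_neqAle lex1 andbT; apply/eqP => e.
have pt : t = p.
  by have := copyK tq; rewrite e (up_id cB (subalg_top cB sA)) meetx1.
have le_t s : T s /\ rk s = c -> s <= p `&` h q0 -> s = t.
  move=> [Ts rs]; rewrite lexI -pt le_eqVlt => /andP[/orP[/eqP//|st] _].
  by case: rT => _ mono _; have := mono _ _ Ts Tt st; rewrite rs ltNge ct.
by apply: nt; rewrite (le_t _ Tt1) // (le_t _ Tt2).
Qed.

Let z_ex : exists z : K, (forall a, z <= a) /\ z < c.
Proof.
have [z0 z0c] := c_pos.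
have [z _ zmin] := ord_min rK (ex_intro [set: K] z0 I).
by exists z; split => [a|]; [exact: zmin | apply: le_lt_trans z0c; exact: zmin].
Qed.

(* The node of rank [a > 0] of the copied tree comes from a node of rank [g a]. *)
Let copied_rank : exists (z : K) (g : K -> K) (rk' : B -> K),
  [/\ forall a, z <= a,
      forall a b, (g a < g b) = (a < b),
      forall a, z < a -> c <= g a,
      rk' \top = z
    & forall q t, branch q t -> g (rk' (h t `&` q)) = rk t /\ z < rk' (h t `&` q)].
Proof.
have [z [zmin zc]] := z_ex.
(* The levels kept are those from [c] on, together with the least rank [z], reserved for the new
   root [\top]. As [z < c], the root does not share its rank with level [c]. *)
have [|g [gX gmono gsurj]] := unbounded_enum rK (X := [set a | a = z \/ c <= a]).
  move=> a; have [ac|/ltW ca] := leP a c; first by exists c; [right|].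
  by exists a => //; right.
have gz : g z = z.
  have [a ga] := gsurj z (or_introl erefl).
  have := zmin a; rewrite le_eqVlt => /orP[/eqP za|/gmono]; first by rewrite {1}za.
  by rewrite ga ltNge zmin.
have glt a b : (g a < g b) = (a < b).
  have [/gmono//|ba|->] := ltgtP a b; last by rewrite ltxx.
  by apply/negbTE; rewrite -leNgt ltW // gmono.
have gc a : z < a -> c <= g a.
  move=> za; case: (gX a) => // e; have := gmono _ _ za.
  by rewrite e ltNge zmin.
have /choice[f fP] : forall b, exists a, c <= b -> g a = b.
  by move=> b; have [cb|?] := leP c b; [have [a ga] := gsurj b (or_intror cb); exists a|exists b].
exists z, g, (fun y => if y == \top then z else f (rk (p `&` h y))).
split => //; first by rewrite eqxx.
move=> q t bqt; have := copy_lt_top bqt; rewrite lt_neqAle => /andP[/negbTE -> _].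
have [_ _ ct tq] := bqt; rewrite copyK // fP //; split => //.
rewrite lt_neqAle zmin andbT; apply/eqP => e.
by have := fP _ ct; rewrite -e gz => rz; move: zc; rewrite rz ltNge ct.
Qed.

Let copied_C : copied_tree `<=` C.
Proof.
move=> y [->|[q [t [[Qq _ _ _] ->]]]]; first exact: subalg_top.
by apply: subalg_meet => //; [apply: AC; exact: up_in | exact: QC].
Qed.

(** From level [c] on a node lies below the product for [q] or is disjoint from it, and [s] meets it
    in at least [t]. *)
Let branch_above q t s : branch q t -> T s -> t <= s -> c <= rk s -> branch q s.
Proof.
move=> [Qq Tt _ tq] Ts ts cs; split => //.
case: (c_decides Qq Ts cs) => // e; case: (node_neq0 sT Tt).
by move: e ts tq; ba B.
Qed.

Let branch_below q t s : branch q t -> T s -> s <= t -> c <= rk s -> branch q s.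
Proof. by move=> [Qq Tt _ tq] Ts st cs; split => //; exact: le_trans tq. Qed.

Let branch0 : branch q0 t1.
Proof. by case: Tt1 => Tt1' r1; split => //; rewrite r1. Qed.

Let branch0' : branch q0 t2.
Proof. by case: Tt2 => Tt2' r2; split => //; rewrite r2. Qed.

(** The part of [x] below a suitable [q] is transported below [p], where it stays nonzero because
    [h p = \top]. A node of [T] of rank at least [c] is found there and copied back. *)
Let copied_dense x : C x -> x <> \bot -> exists2 y, copied_tree y & y <= x.
Proof.
move=> Cx x0; have [q Qq xq0] := bsup_top_neq0 cB Q1 x0.
have Cxq : C (x `&` q) by apply: subalg_meet => //; exact: QC.
have xqE : h (x `&` q) `&` q = x `&` q by apply: (atQ Qq) => //; exact: leIr.
have : p `&` h (x `&` q) <> \bot.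
  move=> e; apply: xq0; apply: (up_eq0 cB (A := A)).
  have Ahxq : A (h (x `&` q)) by exact: up_in.
  by rewrite -[LHS]meetx1 -hp -(up_meet cB sA _ Ahxq) meetC e (up_bot cB sA).
move=> /(node_deep rK sT rT c)[t [Tt txq ct]].
have bqt : branch q t.
  split => //; apply: le_trans txq _; rewrite leI2 // up_mono //; exact: leIr.
exists (h t `&` q); first by right; exists q, t.
apply: le_trans (leIl x q); rewrite -xqE leI2 // up_min //; first exact: up_in.
by apply: le_trans txq _; exact: leIr.
Qed.

Section CopiedRank.
Context (z : K) (g : K -> K) (rk' : B -> K).
Context (zmin : forall a, z <= a) (glt : forall a b, (g a < g b) = (a < b)).
Context (gc : forall a, z < a -> c <= g a) (rk'1 : rk' \top = z).
Context (rk'g : forall q t, branch q t -> g (rk' (h t `&` q)) = rk t).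
Context (rk'z : forall q t, branch q t -> z < rk' (h t `&` q)).

Let g_inj a b : g a = g b -> a = b.
Proof.
move=> e; have [|ba|//] := ltgtP a b; first by rewrite -glt e ltxx.
by rewrite -glt e ltxx in ba.
Qed.

Let copied_above y x : copied_tree y -> copied_tree x -> y < x ->
  exists q t, [/\ branch q t, y = h t `&` q &
    x = \top \/ exists s, [/\ branch q s, x = h s `&` q & t < s]].
Proof.
move=> [->|[q [t [bqt ->]]]] Tx; first by rewrite lt1x.
move=> lt; exists q, t; split => //; case: Tx => [|[q' [s [bqs xE]]]]; [by left|right].
have qq : q = q'.
  by apply: (copy_uniq bqt bqs (copy_neq0 bqt)) => //; rewrite -xE ltW.
subst q'; exists s; split => //; move: lt; rewrite xE.
by have [_ _ _ tq] := bqt; have [_ _ _ sq] := bqs; rewrite copy_lt.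
Qed.

Let copied_ranked : ranked copied_tree rk'.
Proof.
split => [y x x' Ty [Tx yx] [Tx' yx']|x y Tx Ty xy|y b Ty bx].
- have [q [t [bqt yE]]] := copied_above Ty Tx yx.
  case=> [->|[s [bqs xE ts]]]; first by rewrite /Order.comparable lex1 orbT.
  have [q' [t' [bqt' yE']]] := copied_above Ty Tx' yx'.
  case=> [->|[s' [bqs' xE' ts']]]; first by rewrite /Order.comparable lex1.
  have qq : q = q'.
    by apply: (copy_uniq bqt bqt' (copy_neq0 bqt)) => //; rewrite -yE yE'.
  subst q'.
  have [_ Tt _ tq] := bqt; have [_ _ _ tq'] := bqt'.
  have tt : t = t' by rewrite -(copyK tq) -(copyK tq') -yE -yE'.
  subst t'.
  have [_ Ts _ sq] := bqs; have [_ Ts' _ sq'] := bqs'.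
  have : s >=< s' by case: rT => cmp _ _; apply: (cmp t).
  by rewrite /Order.comparable xE xE' !copy_le.
- have [q [t [bqt yE]]] := copied_above Tx Ty xy.
  case=> [->|[s [bqs xE ts]]]; first by rewrite rk'1 yE rk'z.
  rewrite -glt xE yE !rk'g //; case: rT => _ mono _.
  by apply: mono => //; [case: bqt | case: bqs].
- case: Ty bx => [->|[q [t [bqt ->]]]] bx; first by move: bx; rewrite rk'1 ltNge zmin.
  have [zb|bz] := ltP z b; last first.
    exists \top; first by split; [left | exact: copy_lt_top].
    by rewrite rk'1; apply: le_anti; rewrite zmin.
  move: bx; rewrite -glt rk'g // => bx.
  have [_ Tt _ _] := bqt; case: (rT) => _ _ /(_ t _ Tt bx)[s [Ts ts] rs].
  have bqs : branch q s by apply: branch_above bqt Ts (ltW ts) _; rewrite rs gc.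
  exists (h s `&` q).
    split; first by right; exists q, s.
    by have [_ _ _ tq] := bqt; have [_ _ _ sq] := bqs; rewrite copy_lt.
  by apply: g_inj; rewrite rk'g.
Qed.

Let copy_extend q t b : branch q t -> z < b -> rk t <= g b ->
  exists s, [/\ branch q s, s <= t & rk' (h s `&` q) = b].
Proof.
move=> bqt zb tb; have [_ Tt _ _] := bqt.
have [s [Ts st rs]] := node_extend rK sT rT Tt tb.
have bqs : branch q s by apply: branch_below bqt Ts st _; rewrite rs gc.
by exists s; split => //; apply: g_inj; rewrite rk'g.
Qed.

Let copied_extend y b : copied_tree y -> rk' y < b ->
  exists2 x, copied_tree x /\ rk' x = b & x < y.
Proof.
move=> [->|[q [t [bqt ->]]]].
  rewrite rk'1 => zb; have [|s [bqs _ rs]] := copy_extend branch0 zb.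
    by case: Tt1 => _ ->; exact: gc.
  by exists (h s `&` q0); [split => //; right; exists q0, s|exact: copy_lt_top].
move=> tb; have zb : z < b by apply: le_lt_trans tb; exact: zmin.
have [|s [bqs st rs]] := copy_extend bqt zb; first by rewrite -(rk'g bqt) ltW // glt.
exists (h s `&` q); first by split => //; right; exists q, s.
have [_ _ _ tq] := bqt; have [_ _ _ sq] := bqs; rewrite copy_lt //.
rewrite lt_neqAle st andbT; apply: contraTneq tb => <-.
by rewrite rs ltxx.
Qed.

Let copied_disjoint x y : copied_tree x -> copied_tree y -> x `&` y <> \bot -> x >=< y.
Proof.
case=> [->|[q [t [bqt ->]]]]; first by rewrite /Order.comparable lex1 orbT.
case=> [->|[q' [t' [bqt' ->]]]]; first by rewrite /Order.comparable lex1.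
move=> e0; have qq : q = q' by apply: (copy_uniq bqt bqt' e0); [exact: leIl|exact: leIr].
subst q'; have [_ Tt _ tq] := bqt; have [_ Tt' _ tq'] := bqt'.
rewrite /Order.comparable !copy_le //; apply: (node_comparable sT rT Tt Tt').
move=> tt'; apply: e0.
have Att' : A (h t `&` h t') by apply: subalg_meet => //; exact: up_in.
(* An element of [A] disjoint from [p] is [\bot], since its meet with [p] projects back to the
   element itself. *)
have htt' : h t `&` h t' = \bot.
  rewrite -[LHS]meetx1 -hp -(up_meet cB sA _ Att').
  have -> : h t `&` h t' `&` p = (h t `&` p) `&` (h t' `&` p) by ba B.
  by rewrite !pA // ?tt' ?(up_bot cB sA) //; [move: tq'|move: tq]; rewrite lexI => /andP[].
by move: htt'; ba B.
Qed.

Let copied_antichain X : tree_antichain copied_tree X -> card_lt X [set: K].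
Proof.
move=> [XT aX]; apply: ccB; split.
  move=> /XT[/esym e|[q [t [bqt e]]]]; last exact: (copy_neq0 bqt).
  by have := copy_lt_top branch0; rewrite e ltx0.
move=> x y Xx Xy nxy; apply: contrapT => /(copied_disjoint (XT _ Xx) (XT _ Xy)).
by have /negP := aX _ _ Xx Xy nxy.
Qed.

(** Apart from the root, a chain stays below a single [q], where it is a copy of the chain [D] of
    [T]; the factor [nat] makes room for the root. *)
Let copied_chain X : tree_chain copied_tree X -> card_lt X [set: K].
Proof.
move=> [XT cX]; have uK : ~ countable [set: K] by case: rK.
have [[q [t [bqt Xqt]]]|nX] := pselect (exists q t, branch q t /\ X (h t `&` q)); last first.
  apply: countable_card_lt => //; apply: sub_countable (countable1 (\top : B)).
  apply: subset_card_le => y Xy; case: (XT _ Xy) => // -[q [t [bqt e]]].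
  by case: nX; exists q, t; rewrite -e.
pose D := [set s | branch q s /\ X (h s `&` q)].
have smallD : card_lt D [set: K].
  case: (sT) => _ _ _ [[_ _ ch _] _] _; apply: ch; split => [s [[]]//|s s' [bs Xs] [bs' Xs']].
  have := cX _ _ Xs Xs'; have [_ _ _ sq] := bs; have [_ _ _ sq'] := bs'.
  by rewrite /Order.comparable !copy_le.
have Dt : D t by split.
have : card_lt [set: nat * D] [set: K].
  apply: card_lt_nat_prod => //; apply: card_lt_le smallD.
  by have /card_eqPle[] := card_setT D.
apply: card_lt_le.
pose R y (nd : nat * D) := y = \top /\ nd.1 = 0%N \/ y = h (val nd.2) `&` q /\ nd.1 = 1%N.
apply: (card_le_rel (R := R)) => [y Xy|y y' [n [s Ds]] _ _ [] /= [-> ->] [] /= [-> //]].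
case: (XT _ Xy) => [->|[q' [s [bqs yE]]]].
  by exists (0%N, SigSub (mem_set Dt)) => //; left.
have qq : q = q'.
  apply: contrapT => nq; have /(comparable_meet_neq0 (copy_neq0 bqt)) := cX _ _ Xqt Xy.
  rewrite yE => /(_ (copy_neq0 bqs)); apply.
  have [Qq _ _ _] := bqt; have [Qq' _ _ _] := bqs.
  by move: (aQ.2 _ _ Qq Qq' nq); ba B.
subst q'; have Ds : D s by split => //; rewrite -yE.
by exists (1%N, SigSub (mem_set Ds)) => //; right.
Qed.

Let copied_levelE a y : tree_level copied_tree a y <-> copied_tree y /\ rk' y = a.
Proof. exact: ranked_levelE. Qed.

(** Let [I] be the product of the predecessors. Carried back below [p] it lies under every
    predecessor of [t] of rank at least [c], hence under all of them, and so under [t] by the limit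
    condition in [T]. Copying this inequality forward gives [I <= y], because [q] is a relative atom
    of [C]. *)
Let copied_limit a y : limit_ordinal a -> tree_level copied_tree a y ->
  y = binf (tree_preds copied_tree y).
Proof.
move=> [[a0 a0a] lima] /copied_levelE[Ty ra].
apply: le_anti; apply/andP; split; first by apply: le_binf => // x [_ /ltW].
have za : z < a by apply: le_lt_trans a0a; exact: zmin.
case: Ty ra => [->|[q [t [bqt yE]]] ra]; first by rewrite lex1.
set I := binf _; have [Qq Tt ct tq] := bqt.
have rt : rk t = g a by rewrite -ra yE rk'g.
have [a1 za1 a1a] := lima _ za; have [a2 a12 a2a] := lima _ a1a.
(* The renumbering preserves limits: a rank between [c] and [g a] is a value of [g], and a rank
   below [c] is surpassed by the value at [a2]. *)
have lim_ga : limit_ordinal (g a).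
  split; first by exists (g z); rewrite glt.
  move=> b bga; have bt : b <= rk t by rewrite rt ltW.
  have [s [Ts ts rs]] := node_above rT Tt bt.
  have [cb|bc] := leP c b; last first.
    by exists (g a2); rewrite ?glt //; apply: lt_le_trans bc (le_trans (gc za1) _); rewrite ltW // glt.
  have bqs : branch q s by apply: branch_above bqt Ts ts _; rewrite rs.
  have : rk' (h s `&` q) < a by rewrite -glt rk'g // rs.
  by move=> /lima[e re ea]; exists (g e); rewrite ?glt // -rs -(rk'g bqs) glt.
have Tt_lim : tree_level T (g a) t by apply/(ranked_levelE rK _ _ rT).
have tE : t = binf (tree_preds T t) by case: (sT) => _ _ _ _ h; exact: (h _ _ lim_ga).
have above u : tree_preds T t u -> c <= rk u -> branch q u /\ I <= h u `&` q.
  move=> [Tu tu] cu; have bqu : branch q u by apply: branch_above bqt Tu (ltW tu) cu.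
  split => //; apply: binf_lb => //; split; first by right; exists q, u.
  by rewrite yE; have [_ _ _ uq] := bqu; rewrite copy_lt.
have [s1 [Ts1 ts1 rs1]] : exists s1, [/\ T s1, t < s1 & rk s1 = g a1].
  case: (rT) => _ _ /(_ t (g a1) Tt); rewrite rt glt => /(_ a1a)[s [Ts ts] rs].
  by exists s.
have cs1 : c <= rk s1 by rewrite rs1 gc.
have [bs1 Is1] := above _ (conj Ts1 ts1) cs1.
have Iq : I <= q by apply: le_trans Is1 (leIr _ _).
have IC : C I by apply: subalg_binf => // x [/copied_C].
have pI u : tree_preds T t u -> c <= rk u -> p `&` h I <= u.
  move=> Pu cu; have [bqu Iu] := above u Pu cu; have [_ _ _ uq] := bqu.
  by rewrite -[leRHS](copyK uq) leI2 // up_mono.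
have It : p `&` h I <= t.
  rewrite [leRHS]tE; apply: le_binf => // u Pu; have [cu|uc] := leP c (rk u).
    exact: pI.
  apply: le_trans (pI _ (conj Ts1 ts1) cs1) _.
  have [Tu tu] := Pu; apply: (node_le sT rT) => //; last exact: le_trans (ltW uc) cs1.
  move=> e; apply: (node_neq0 sT Tt); move: e (ltW tu) (ltW ts1); ba B.
have hI : h (p `&` h I) = h I.
  by rewrite meetC up_meet ?hp ?meetx1 //; exact: up_in.
by rewrite yE -[I](atQ Qq IC Iq) -hI leI2 // up_mono.
Qed.

Lemma copied_souslinization_ranked : souslinization K C copied_tree.
Proof.
split => //.
- case=> [e|[q [t [bqt e]]]]; last exact: (copy_neq0 bqt).
  by have := copy_lt_top branch0; rewrite -e ltx0.
- split; first split => //.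
  + exact: ranked_is_tree copied_ranked.
  + split => [y Ty|a]; first by exists (rk' y); apply/copied_levelE.
    have [za|az] := ltP z a; last first.
      exists \top; apply/copied_levelE; split; first by left.
      by apply: le_anti; rewrite rk'1 zmin.
    have [|x [Tx rx] _] := copied_extend (or_introl erefl : copied_tree \top) (b := a).
      by rewrite rk'1.
    by exists x; apply/copied_levelE.
  split => [|y Ty|a b y /copied_levelE[Ty <-] ab|a y y' lima ly ly' e].
  + by exists \top => [|t _]; [left|exact: lex1].
  + case: Ty => [->|[q [t [bqt ->]]]].
      (* The root splits because level [c] has two nodes below the product for [q0], and their
         copies come directly after the root. *)
      exists (h t1 `&` q0), (h t2 `&` q0).
      have imm s : branch q0 s -> rk s = c ->
          immediate_successor copied_tree \top (h s `&` q0).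
        move=> bqs rs; split; [by right; exists q0, s|exact: copy_lt_top|].
        case=> u [Tu su u1]; have Ts : copied_tree (h s `&` q0) by right; exists q0, s.
        have [q [v [bqv e ]]] := copied_above Ts Tu su.
        case=> [u_top|[w [[_ Tw cw _] _ vw]]]; first by rewrite u_top ltxx in u1.
        have qq : q0 = q.
          by apply: (copy_uniq bqs bqv (copy_neq0 bqs)) => //; rewrite e.
        subst q; have vs : v = s.
          have [_ _ _ vq] := bqv; have [_ _ _ sq] := bqs.
          by rewrite -(copyK vq) -(copyK sq) -e.
        subst v; have [_ Ts' _ _] := bqs; case: rT => _ mono _.
        by have := mono _ _ Ts' Tw vw; rewrite rs ltNge cw.
      split; [by apply: imm; case: Tt1|by apply: imm; case: Tt2|].
      by move=> e; apply: nt; rewrite -(copyK t1p) -(copyK t2p) e.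
    have [_ Tt ct tq] := bqt.
    case: (sT) => _ _ _ [_ [_ /(_ t Tt)[s1 [s2 [i1 i2 ns]]] _ _]] _.
    have imm s : immediate_successor T t s -> branch q s /\
        immediate_successor copied_tree (h t `&` q) (h s `&` q).
      move=> [Ts st is_]; have bqs : branch q s.
        have lt_rk : rk t < rk s by case: rT => _ mono _; exact: mono _ _ Ts Tt st.
        exact: branch_below bqt Ts (ltW st) (le_trans ct (ltW lt_rk)).
      have [_ _ _ sq] := bqs; split => //; split; [by right; exists q, s|by rewrite copy_lt|].
      case=> u [Tu su ut]; have Ts' : copied_tree (h s `&` q) by right; exists q, s.
      have Tt' : copied_tree (h t `&` q) by right; exists q, t.
      have [q1 [v [bqv e]]] := copied_above Tu Tt' ut.
      case=> [u_top|[w [bqw tw vw]]]; first by have := copy_lt_top bqt; rewrite u_top ltxx.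
      have qq : q1 = q.
        by apply: (copy_uniq bqv bqt (copy_neq0 bqv)); rewrite -?e // ltW.
      subst q1; apply: is_; exists v; have [_ Tv _ vq] := bqv.
      rewrite e in su ut; split => //; first by rewrite -(copy_lt (q := q)).
      by rewrite -(copy_lt (q := q)).
    have [b1 j1] := imm _ i1; have [b2 j2] := imm _ i2.
    exists (h s1 `&` q), (h s2 `&` q); split => // e; apply: ns.
    by have [_ _ _ v1] := b1; have [_ _ _ v2] := b2; rewrite -(copyK v1) -(copyK v2) e.
  + have [x [Tx rx] xy] := copied_extend Ty ab.
    by exists x => //; apply/copied_levelE.
  + by rewrite (copied_limit lima ly) (copied_limit lima ly') e.
Qed.

End CopiedRank.

Lemma copied_souslinization : souslinization K C copied_tree.
Proof.
have [z [g [rk' [zmin glt gc rk'1 rk'P]]]] := copied_rank.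
apply: (copied_souslinization_ranked zmin glt gc rk'1) => q t /rk'P[]; [|]; by [].
Qed.

End CopiedTree.

(** * Large subalgebras *)

Definition local_algebra (d : Order.disp_t) (L : ctbDistrLatticeType d)
    (P : set L) (p : L) : Prop :=
  [/\ P p /\ (forall x, P x -> x <= p),
      forall x y, P x -> P y -> P (x `&` y),
      forall x y, P x -> P y -> P (x `|` y)
    & forall x, P x -> P (p `\` x)].

(** The Boolean operations are determined by the order, so a surjective order embedding preserves
    them. *)
Lemma order_boolean_isomorphism (d d' : Order.disp_t)
    (L : ctbDistrLatticeType d) (L' : ctbDistrLatticeType d')
    (P : set L) (p : L) (Q : set L') (q : L') (f : L -> L') :
  local_algebra P p -> local_algebra Q q ->
  (forall x, P x -> Q (f x)) -> (forall y, Q y -> exists2 x, P x & f x = y) ->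
  (forall x y, P x -> P y -> (f x <= f y) = (x <= y)) ->
  boolean_isomorphism P p Q q f.
Proof.
move=> [[Pp Pmax] PI PU PD] [[Qq Qmax] QI QU QD] fQ surj fle.
have fI x y : P x -> P y -> f (x `&` y) = f x `&` f y.
  move=> Px Py; apply: le_anti; rewrite lexI !fle ?leIl ?leIr //; do ?exact: PI.
  have [z Pz zE] := surj _ (QI _ _ (fQ _ Px) (fQ _ Py)).
  by rewrite -zE fle ?lexI -?fle // ?zE ?leIl ?leIr //; exact: PI.
have fU x y : P x -> P y -> f (x `|` y) = f x `|` f y.
  move=> Px Py; apply: le_anti; rewrite leUx !fle ?leUl ?leUr ?andbT //; do ?exact: PU.
  have [z Pz zE] := surj _ (QU _ _ (fQ _ Px) (fQ _ Py)).
  by rewrite -zE fle ?leUx -?fle // ?zE ?leUl ?leUr //; exact: PU.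
split => //.
  split => [x /fQ//|x y /set_mem Px /set_mem Py e|y /surj[x Px <-]]; last by exists x.
  by apply: le_anti; rewrite -!fle // e lexx.
move=> x Px; have fp : f p = q.
  apply: le_anti; rewrite (Qmax _ (fQ _ Pp)) /=.
  by have [z Pz <-] := surj _ Qq; rewrite fle // Pmax.
have P0 : P \bot by rewrite -(diffxx p); exact: PD.
have f0 : f \bot = \bot.
  apply/eqP; rewrite -lex0; have [|z Pz <-] := surj \bot.
    by rewrite -(diffxx q); exact: QD.
  by rewrite fle // le0x.
have Pd := PD _ Px.
have : f (p `\` x) `&` f x = \bot by rewrite -fI // -f0; congr f; ba L.
have : f (p `\` x) `|` f x = q.
  by rewrite -fU // -fp; congr f; move: (Pmax _ Px); ba L.
ba L'.
Qed.

Lemma local_algebra_relative (d : Order.disp_t) (B : ctbDistrLatticeType d)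
    (cB : complete_algebra B) (A : set B) (a : B) :
  complete_subalgebra A -> A a -> local_algebra (relative_algebra A a) a.
Proof.
move=> sA Aa; split => [|x y [Ax xa] [Ay ya]|x y [Ax xa] [Ay ya]|x [Ax xa]].
- by split => [|x []//]; split.
- by split; [exact: subalg_meet|move: xa; ba B].
- by split; [exact: subalg_join|rewrite leUx xa].
- by split; [rewrite diffE; apply: subalg_meet => //; exact: subalg_compl|ba B].
Qed.

Lemma local_algebra_subalg (d : Order.disp_t) (B : ctbDistrLatticeType d)
    (cB : complete_algebra B) (A : set B) :
  complete_subalgebra A -> local_algebra A \top.
Proof.
move=> sA; have := local_algebra_relative cB sA (subalg_top cB sA).
by congr local_algebra; apply/funext => x; apply/propext; split => [[]//|Ax]; split; rewrite ?lex1.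
Qed.

Lemma boolean_isomorphic_trans (d1 d2 d3 : Order.disp_t)
    (L1 : ctbDistrLatticeType d1) (L2 : ctbDistrLatticeType d2) (L3 : ctbDistrLatticeType d3)
    (P1 : set L1) p1 (P2 : set L2) p2 (P3 : set L3) p3 :
  boolean_isomorphic P1 p1 P2 p2 -> boolean_isomorphic P2 p2 P3 p3 ->
  boolean_isomorphic P1 p1 P3 p3.
Proof.
move=> [f [bf fI fU fD]] [g [bg gI gU gD]]; have [ff _ _] := bf.
exists (g \o f); split => [|x y Px Py|x y Px Py|x Px] /=.
- exact: set_bij_comp bf bg.
- by rewrite fI // gI //; exact: ff.
- by rewrite fU // gU //; exact: ff.
- by rewrite fD // gD //; exact: ff.
Qed.

Section Large.
Context (dK : Order.disp_t) (K : orderType dK) (rK : regular_uncountable K).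
Context (d : Order.disp_t) (B : ctbDistrLatticeType d) (cB : complete_algebra B).
Context (ccB : kappa_cc B K) (disB : kappa_distributive B K).
Context (A : set B) (sA : complete_subalgebra A).
Context (M : set B) (aM : antichain M) (M1 : bsup M = \top).
Context (atM : forall m, M m -> relative_atom A setT m).
Local Notation h := (upper_projection A).
Implicit Types (a m x y : B).

Lemma bsup_top_maximal N : N `<=` A -> antichain N -> bsup N = \top ->
  maximal_antichain_in A N.
Proof.
move=> NA aN N1; split => // N' N'A [N'0 aN'] NN'; apply/seteqP; split => // x N'x.
have [|a Na xa] := bsup_top_neq0 cB N1 (_ : x <> \bot); first by move=> x0; rewrite x0 in N'x.
by have [->//|/(aN' _ _ N'x (NN' _ Na))] := pselect (x = a).
Qed.

(** The members of [N] are the nonzero products that choose, for each [m], either [h m] or its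
    complement. Their join is [\top] by the distributive law, which applies because the chain
    condition makes [M] small. *)
Lemma deciding_antichain : exists N : set B, [/\ N `<=` A, antichain N, bsup N = \top
  & forall a m, N a -> M m -> a <= h m \/ a `&` h m = \bot].
Proof.
pose b (i : M) (e : bool) := if e then h (val i) else ~` h (val i).
have smallM : card_lt [set: M] [set: K].
  by apply: card_lt_le (ccB aM); have /card_eqPle[] := card_setT M.
pose N0 := range (fun f : M -> bool => binf (range (fun i => b i (f i)))).
have N01 : bsup N0 = \top.
  rewrite /N0 -(disB b smallM); apply/eqP; rewrite -le1x; apply: (le_binf cB) => _ [i _ <-].
  rewrite -(joinxC (h (val i))) leUx; apply/andP; split; apply: bsup_ub => //.
    by exists true.
  by exists false.
have AN0 : N0 `<=` A.
  move=> _ [f _ <-]; apply: subalg_binf => // _ [i _ <-]; rewrite /b.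
  by case: (f i); [exact: up_in|apply: subalg_compl => //; exact: up_in].
exists [set a | N0 a /\ a <> \bot]; split => [a [/AN0]//|||a m [[f _ <-] _] Mm].
- split => [[]//|_ _ [[f _ <-] _] [[f' _ <-] _] nff'].
  have [i fi] : exists i, f i <> f' i.
    apply/existsNP => ff; apply: nff'; suff -> : f = f' by [].
    exact/funext.
  have l1 : binf (range (fun i => b i (f i))) <= b i (f i) by apply: binf_lb => //; exists i.
  have l2 : binf (range (fun i => b i (f' i))) <= b i (f' i) by apply: binf_lb => //; exists i.
  by move: fi l1 l2; rewrite /b; case: (f i); case: (f' i) => // _; ba B.
- apply/eqP; rewrite -le1x -N01; apply: bsup_le => // a N0a.
  by have [->|a0] := pselect (a = \bot); [exact: le0x|apply: (bsup_ub cB)].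
- have : binf (range (fun i => b i (f i))) <= b (SigSub (mem_set Mm)) (f (SigSub (mem_set Mm))).
    by apply: binf_lb => //; exists (SigSub (mem_set Mm)).
  by rewrite /b; case: (f _) => /= l; [left|right; move: l; ba B].
Qed.

Lemma decided_fiber N a : bsup N = \top -> antichain N ->
    (forall a m, N a -> M m -> a <= h m \/ a `&` h m = \bot) -> N a ->
  forall x, x `&` a <> \bot -> exists m, [/\ M m, a <= h m & x `&` a `&` m <> \bot].
Proof.
move=> N1 aN dN Na x xa0; have [m Mm xam] := bsup_top_neq0 cB M1 xa0.
exists m; split => //; case: (dN a m Na Mm) => // am; case: xam.
by move: am (le_up cB A m); ba B.
Qed.

Lemma full_relative_atom : exists p, relative_atom A setT p /\ h p = \top.
Proof.
have [N [NA aN N1 dN]] := deciding_antichain.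
have /choice[f fP] : forall a, exists m, N a -> M m /\ a <= h m.
  move=> a; have [Na|nNa] := pselect (N a); last by exists a.
  have [|m [Mm am _]] := decided_fiber N1 aN dN Na (x := \top).
    by rewrite meet1x => a0; apply: aN.1; rewrite -a0.
  by exists m.
pose P := [set a `&` f a | a in N].
have pa a : N a -> bsup P `&` a <= f a.
  move=> Na; apply: meet_bsup_le => // _ [a' Na' <-].
  have [->|nn] := pselect (a = a'); first by ba B.
  by move: (aN.2 _ _ Na Na' nn); ba B.
exists (bsup P); split => [x _ xP|].
  apply: le_anti; rewrite lexI le_up //= xP andbT meetC.
  apply: meet_bsup_le => // _ [a Na <-]; have [Mfa _] := fP _ Na.
  have xaf : a `&` x <= f a by apply: le_trans (pa _ Na); move: xP; ba B.
  have := atM Mfa I xaf; rewrite up_meet ?NA //; last exact: NA.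
  ba B.
apply/eqP; rewrite -le1x -N1; apply: bsup_le => // a Na; have [Mfa af] := fP _ Na.
have : h (a `&` f a) <= h (bsup P) by apply: up_mono => //; apply: bsup_ub => //; exists a.
by rewrite up_meet //; [move: af; ba B|exact: NA].
Qed.

(** Meeting with [p] is inverted by [h]: on one side because [h p = \top], on the other because [p]
    is a relative atom. *)
Lemma large_isomorphic_relative p : relative_atom A setT p -> h p = \top ->
  boolean_isomorphic A \top (relative_algebra setT p) p.
Proof.
move=> pA hp; exists (fun x => x `&` p); apply: order_boolean_isomorphism.
- exact: local_algebra_subalg.
- exact: local_algebra_relative.
- by move=> x _; split => //; exact: leIr.
- by move=> y [_ yp]; exists (h y); [exact: up_in|exact: pA].
move=> x y Ax Ay; apply/idP/idP => xy; last by apply: leI2.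
by have := up_mono cB sA xy; rewrite !up_meet // hp !meetx1.
Qed.

(** The exponent at [a] is the set of the [m] with [a <= h m]. The algebra splits into the pieces
    below the meets of [a] and [m], and [h] maps each such piece isomorphically onto [A] below
    [a]. *)
Lemma large_product : exists (N : set B) (f : N -> Type),
  maximal_antichain_in A N /\
  boolean_isomorphic [set: B] \top (product_of_powers A f) (power_top f).
Proof.
have [N [NA aN N1 dN]] := deciding_antichain.
pose f (a : N) := {m : B | M m /\ val a <= h m}.
exists N, f; split; first exact: bsup_top_maximal.
have aA (a : N) : A (val a) by apply: NA; exact: set_valP.
pose F x (j : power_index f) := h (x `&` power_top f j `&` sval (projT2 j)).
have jP j : M (sval (projT2 j)) /\ power_top f j <= h (sval (projT2 j)).
  by case: j => a [m]; rewrite /power_top.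
have FE x j : F x j `&` sval (projT2 j) = x `&` power_top f j `&` sval (projT2 j).
  by apply: (atM (jP j).1) => //; exact: leIr.
exists F; apply: order_boolean_isomorphism.
- exact: local_algebra_subalg.
- have lj (j : power_index f) := local_algebra_relative cB sA (aA (projT1 j)).
  split => [|x y Px Py j|x y Px Py j|x Px j].
  + split => [j|x Px]; first by case: (lj j) => [[top_j _] _ _ _]; exact: top_j.
    by apply/lefP => j; case: (Px j) => _; exact.
  + by have [_ h1 _ _] := lj j; exact: (h1 _ _ (Px j) (Py j)).
  + by have [_ _ h1 _] := lj j; exact: (h1 _ _ (Px j) (Py j)).
  + by have [_ _ _ h1] := lj j; have := h1 _ (Px j); rewrite !diffE; exact.
- move=> x _ j; split; first exact: up_in.
  by apply: up_min => //; [exact: aA|rewrite -meetA meetCA leIl].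
- move=> g gP; exists (bsup [set g j `&` sval (projT2 j) | j in [set: power_index f]]) => //.
  apply/funext => j; rewrite /F.
  have gj : g j <= power_top f j by have [] := gP j.
  have gA : A (g j) by have [] := gP j.
  have -> : bsup [set g j `&` sval (projT2 j) | j in [set: power_index f]]
      `&` power_top f j `&` sval (projT2 j) = g j `&` sval (projT2 j).
    apply: le_anti; apply/andP; split; last first.
      rewrite !lexI leIr andbT; apply/andP; split; first by apply: bsup_ub => //; exists j.
      exact: le_trans (leIl _ _) gj.
    rewrite -meetA; apply: meet_bsup_le => // _ [j' _ <-].
    have gj' : g j' <= power_top f j' by have [] := gP j'.
    have [ee|ne] := pselect (val (projT1 j) = val (projT1 j')); last first.
      have := aN.2 _ _ (set_valP (projT1 j)) (set_valP (projT1 j')) ne.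
      by move: gj'; rewrite /power_top; ba B.
    have [em|nm] := pselect (sval (projT2 j) = sval (projT2 j')); last first.
      by have := aM.2 _ _ (jP j).1 (jP j').1 nm; ba B.
    suff -> : j' = j by exact: leIl.
    clear gj gA gj'; case: j j' ee em => [a [m mP]] [a' [m' mP']] /= /val_inj ea em.
    by subst a' m'; rewrite (Prop_irrelevance mP mP').
  rewrite up_meet //; apply/meet_l/(le_trans gj); exact: (jP j).2.
move=> x y _ _; apply/lefP/idP => [Fxy|xy j]; last first.
  by apply: up_mono => //; apply: leI2 => //; apply: leI2.
suff : x `&` ~` y = \bot by ba B.
apply: contrapT => xy0; have [a Na xya] := bsup_top_neq0 cB N1 xy0.
have [m [Mm am xyam]] := decided_fiber N1 aN dN Na xya.
pose j : power_index f := existT _ (SigSub (mem_set Na)) (exist _ m (conj Mm am)).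
apply: xyam; move: (FE x j) (FE y j) (Fxy j) => /=; rewrite /power_top /=; ba B.
Qed.

(** The witness is the copied tree for [M]. Its projection is shown to be the copied tree for the
    single relative atom [\top] of [A], so the same lemma makes both Souslinizations. *)
Lemma large_nice : (exists T : set B, souslinization K setT T) -> nice K A.
Proof.
move=> [T sT]; have [rk rT] := souslinization_ranked rK sT.
have [p [pA hp]] := full_relative_atom.
have smallX : card_lt [set p `&` h q | q in M] [set: K].
  exact: card_lt_le (card_image_le _ _) (ccB aM).
have [c1 c1P] := node_decides rK ccB sT rT smallX.
have [c2 c2P] := node_decides rK ccB sT rT (countable_small rK (countable1 p)).
have p0 : p <> \bot.
  move=> p0; apply: (souslinization_top_neq0 sT).
  by rewrite -hp p0; exact: up_bot.
have [q0 Mq0 pq0] := bsup_top_neq0 cB M1 p0.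
have phq0 : p `&` h q0 <> \bot by move=> e; apply: pq0; move: e (le_up cB A q0); ba B.
(* The level [c] lies beyond [c1], which decides the products for [M], and beyond [c2], which
   decides [p] for the tree of [A]; it also carries the splitting that the root needs. *)
have [c [t1 [t2 [c12 Tt1 Tt2 [t1p t2p] nt]]]] := node_split rK sT rT (Order.max c1 c2) phq0.
move: c12; rewrite gt_max => /andP[c1c c2c].
have c_pos : exists z, z < c by exists c1.
have dM q t : M q -> T t -> c <= rk t -> t <= p `&` h q \/ t `&` (p `&` h q) = \bot.
  by move=> Mq Tt ct; apply: c1P => //; [exists q|exact: le_trans (ltW c1c) ct].
have h1 : h \top = \top by apply: up_id => //; exact: subalg_top.
have d1 q t : [set \top] q -> T t -> c <= rk t -> t <= p `&` h q \/ t `&` (p `&` h q) = \bot.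
  by move=> -> Tt ct; rewrite h1 meetx1; apply: c2P => //; exact: le_trans (ltW c2c) ct.
have a1 : antichain [set (\top : B)].
  by split => [/esym e|x y -> ->//]; apply: p0; apply/eqP; rewrite -lex0 -e lex1.
exists (copied_tree T rk A p M c).
  apply: (copied_souslinization rK cB ccB sT rT sA pA hp _ _ _ aM M1 _ c_pos dM Mq0 Tt1 Tt2 nt t1p t2p) => //.
have -> : [set h t | t in copied_tree T rk A p M c] = copied_tree T rk A p [set \top] c.
  have hcopy q t : t <= p `&` h q -> h (h t `&` q) = h t.
    rewrite lexI => /andP[_ tq]; rewrite up_meet //; last exact: up_in.
    by apply/meet_l/up_min => //; exact: up_in.
  apply/seteqP; split => [_ [_ [->|[q [t [[Mq Tt ct tq] ->]]]] <-]|_ [->|[q [t [[-> Tt ct tp] ->]]]]].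
  - by left.
  - right; exists \top, t; rewrite hcopy // meetx1; split => //; split => //.
    by rewrite h1 meetx1; move: tq; rewrite lexI => /andP[].
  - by exists \top => //; left.
  (* Every node below [p] has to be hit by the projection: it meets some [m], and being of rank at
     least [c] it then lies below [h m]. *)
  - have [m Mm tm0] := bsup_top_neq0 cB M1 (node_neq0 sT Tt).
    have bqt : branch T rk A p M c m t.
      split => //; case: (dM m t Mm Tt ct) => // e; case: tm0.
      by move: e tp (le_up cB A m); ba B.
    exists (h t `&` m); first by right; exists m, t.
    by rewrite meetx1 hcopy //; case: bqt.
apply: (copied_souslinization rK cB ccB sT rT sA pA hp sA _ _ a1 _ _ c_pos d1 (erefl : [set \top] \top) Tt1 Tt2 nt) => //.
- by move=> q ->; exact: subalg_top.
- exact: supremum1.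
- by move=> q -> x Ax _; rewrite meetx1; exact: up_id.
- by rewrite h1 meetx1; move: t1p; rewrite lexI => /andP[].
- by rewrite h1 meetx1; move: t2p; rewrite lexI => /andP[].
Qed.

End Large.

(** * Swaps of relative atoms *)

Section Swaps.
Context (d : Order.disp_t) (B : ctbDistrLatticeType d) (cB : complete_algebra B).
Context (A : set B) (sA : complete_subalgebra A).
Local Notation h := (upper_projection A).
Implicit Types (c m n x y : B).

(* Exchanges the copies [c & m] and [c & n] of [A] below [c]. *)
Definition swap m n c x : B :=
  (x `\` (c `&` (m `|` n))) `|` (h (x `&` m) `&` c `&` n) `|` (h (x `&` n) `&` c `&` m).

Lemma swap_mono m n c x y : x <= y -> swap m n c x <= swap m n c y.
Proof.
move=> xy; have hm : h (x `&` m) <= h (y `&` m) by apply: up_mono => //; exact: leI2.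
have hn : h (x `&` n) <= h (y `&` n) by apply: up_mono => //; exact: leI2.
by rewrite /swap; move: xy hm hn; ba B.
Qed.

Lemma swap_move m n c : m `&` n = \bot -> A c -> c <= h m -> swap m n c (c `&` m) = c `&` n.
Proof.
move=> mn Ac cm; rewrite /swap.
have -> : c `&` m `&` n = \bot by move: mn; ba B.
have -> : c `&` m `&` m = c `&` m by ba B.
by rewrite up_meet // (up_bot cB sA); move: cm mn; ba B.
Qed.

Lemma swap_disjoint m n c x : x `&` (m `|` n) = \bot -> swap m n c x = x.
Proof.
move=> x0; rewrite /swap.
have -> : x `&` m = \bot by move: x0; ba B.
have -> : x `&` n = \bot by move: x0; ba B.
by rewrite (up_bot cB sA); move: x0; ba B.
Qed.

Context (m n c : B) (mn : m `&` n = \bot) (Ac : A c) (cm : c <= h m) (cn : c <= h n).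

Lemma swap_fixes x : A x -> swap m n c x = x.
Proof. by move=> Ax; rewrite /swap !up_meet //; move: mn cm cn; ba B. Qed.

Context (atm : relative_atom A setT m) (atn : relative_atom A setT n).

(** Inside [c] the swap exchanges the projections of the traces on [m] and on [n], and a relative
    atom recovers each trace from its projection. *)
Lemma swapK : cancel (swap m n c) (swap m n c).
Proof.
move=> x; set w := swap m n c x.
have Ahm : A (h (x `&` m) `&` c) by apply: subalg_meet => //; exact: up_in.
have Ahn : A (h (x `&` n) `&` c) by apply: subalg_meet => //; exact: up_in.
have wm : h (w `&` m) `&` c = h (x `&` n) `&` c.
  rewrite meetC -up_meet //.
  have -> : c `&` (w `&` m) = h (x `&` n) `&` c `&` m by rewrite /w /swap; move: mn; ba B.
  by rewrite up_meet //; move: cm; ba B.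
have wn : h (w `&` n) `&` c = h (x `&` m) `&` c.
  rewrite meetC -up_meet //.
  have -> : c `&` (w `&` n) = h (x `&` m) `&` c `&` n by rewrite /w /swap; move: mn; ba B.
  by rewrite up_meet //; move: cn; ba B.
rewrite {1}/swap wm wn /w /swap.
move: (atm I (leIr m x)) (atn I (leIr n x)) mn; ba B.
Qed.

Lemma swap_automorphism : automorphism (swap m n c).
Proof.
apply: order_boolean_isomorphism => //; try exact: local_algebra_subalg.
  by move=> y _; exists (swap m n c y) => //; exact: swapK.
move=> x y _ _; apply/idP/idP => [/(swap_mono m n c)|]; first by rewrite !swapK.
exact: swap_mono.
Qed.

End Swaps.

(** * Groups generated by involutions *)

Section GeneratedGroup.
Context (d : Order.disp_t) (B : ctbDistrLatticeType d).
Context (Y : Type) (s : Y -> B -> B).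
Context (s_aut : forall y, automorphism (s y)) (sK : forall y, cancel (s y) (s y)).

Definition word (w : seq Y) : B -> B := foldr (fun y phi => s y \o phi) idfun w.

Lemma word_cat w w' : word (w ++ w') = word w \o word w'.
Proof. by elim: w => //= y w ->. Qed.

(** The generators are involutions, so reversing a word inverts it. *)
Lemma word_revK w : cancel (word w) (word (rev w)).
Proof.
elim: w => //= y w IH x; rewrite rev_cons -cats1 word_cat /=.
by rewrite sK IH.
Qed.

Lemma word_group : automorphism_group (range word).
Proof.
split => [_ [w _ <-]||_ _ [w _ <-] [w' _ <-]|_ [w _ <-]].
- elim: w => [|y w [bw wI wU wD]] /=; first by split => //; exact: set_bij_id.
  have [bs sI sU sD] := s_aut y; split => [|x x' _ _|x x' _ _|x _] /=.
  + exact: set_bij_comp bw bs.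
  + by rewrite wI // sI.
  + by rewrite wU // sU.
  + by rewrite wD // sD.
- by exists [::].
- by exists (w ++ w') => //; exact: word_cat.
- exists (word (rev w)); split; [by exists (rev w)|exact: word_revK|].
  by rewrite -{2}(revK w); exact: word_revK.
Qed.

Lemma word1 y : range word (s y).
Proof. by exists [:: y] => //; apply/funext. Qed.

Lemma fixed_points_word : fixed_points (range word) = [set x | forall y, s y x = x].
Proof.
apply/seteqP; split => [x fx y|x fx _ [w _ <-]]; first exact/fx/word1.
by elim: w => //= y w ->.
Qed.

End GeneratedGroup.

(** * The group of swaps and its size *)

Section SwapGroup.
Context (d : Order.disp_t) (B : ctbDistrLatticeType d) (cB : complete_algebra B).
Context (A : set B) (sA : complete_subalgebra A).
Context (M : set B) (aM : antichain M) (M1 : bsup M = \top).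
Context (atM : forall m, M m -> relative_atom A setT m).
Local Notation h := (upper_projection A).
Local Notation full_swap m n := (swap A m n (h m `&` h n)).
Implicit Types (c m n x y : B).

(** Invariance under the swap of [m] and [n] puts the part of [h (x & m)] below [n] into [x]. As [M]
    has join [\top], all of [h (x & m)] lies in [x], so [x] is the join of these projections. *)
Lemma fixed_by_swaps x :
  (forall m n, M m -> M n -> m <> n -> full_swap m n x = x) -> A x.
Proof.
move=> fx; have -> : x = bsup [set h (x `&` m) | m in M].
  apply: le_anti; apply/andP; split.
    rewrite -[x in X in X <= _]meet1x -M1; apply: meet_bsup_le => // m Mm.
    apply: le_trans (_ : h (x `&` m) <= _); first by rewrite meetC; exact: le_up.
    by apply: bsup_ub => //; exists m.
  apply: bsup_le => // _ [m Mm <-]; rewrite -[leLHS]meet1x -M1.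
  apply: meet_bsup_le => // n Mn.
  have [<-|nmn] := pselect (m = n).
    by rewrite meetC (atM Mm I (leIr _ _)) leIl.
  have hm : h (x `&` m) <= h m by apply: up_mono => //; exact: leIr.
  move: (fx _ _ Mm Mn nmn) hm (le_up cB A n); rewrite /swap; ba B.
by apply: subalg_bsup => // _ [m _ <-]; exact: up_in.
Qed.

(** The sequence [e] is a reserve of further involutions fixing [A], used to make the group infinite
    when [M] is finite. The group consists of words over countably many letters and the pairs from
    [M], whence the bound on its size. *)
Lemma swap_group (e : nat -> B -> B) :
  (forall k, [/\ automorphism (e k), cancel (e k) (e k) & forall x, A x -> e k x = x]) ->
  exists G : set (B -> B), [/\ automorphism_group G, A = fixed_points G,
    forall k, G (e k),
    forall m n, M m -> M n -> m <> n -> G (full_swap m n)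
    & forall Z, infinite_set [set: Z] -> M #<= [set: Z] -> G #<= [set: Z]].
Proof.
move=> eP; pose Y := (M * M + nat)%type.
pose s (y : Y) := match y with
  | inl mn => if mn.1 == mn.2 then idfun else full_swap (val mn.1) (val mn.2)
  | inr k => e k
  end.
have hh m n : [/\ A (h m `&` h n), h m `&` h n <= h m & h m `&` h n <= h n].
  by split; [apply: subalg_meet => //; exact: up_in|exact: leIl|exact: leIr].
have MM (m n : M) : m != n -> val m `&` val n = \bot.
  move=> mn; apply: aM.2; [exact: set_valP|exact: set_valP|].
  by move=> /val_inj/eqP; rewrite (negbTE mn).
have sP (y : Y) : [/\ automorphism (s y), cancel (s y) (s y) & forall x, A x -> s y x = x].
  case: y => [[m n]|k] /=; last exact: eP.
  have [_|mn] := eqVneq m n.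
    by split => //; split => //; exact: set_bij_id.
  have [Ahh hm hn] := hh (val m) (val n).
  split => [||x].
  - by apply: swap_automorphism; rewrite ?MM //; apply: atM; exact: set_valP.
  - by apply: swapK; rewrite ?MM //; apply: atM; exact: set_valP.
  - by apply: swap_fixes; rewrite ?MM.
exists (range (word s)); split.
- by apply: word_group => y; have [] := sP y.
- rewrite fixed_points_word; apply/seteqP; split => [x Ax y|x fx].
    by have [_ _] := sP y; exact.
  apply: fixed_by_swaps => m n Mm Mn mn.
  have := fx (inl (SigSub (mem_set Mm), SigSub (mem_set Mn))) => /=.
  by case: eqP => // /(congr1 val).
- by move=> k; exact: (word1 s (inr k)).
- move=> m n Mm Mn mn.
  have := word1 s (inl (SigSub (mem_set Mm), SigSub (mem_set Mn))) => /=.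
  by case: eqP => // /(congr1 val).
move=> Z iZ MZ; apply: card_le_trans (card_image_le _ _) _.
have iY : infinite_set [set: Y].
  by apply/infiniteP/card_le_setTP; exists inr => k k' [].
apply: card_le_trans (infinite_card_seq iY) _.
have /card_le_setTP[c cinj] := infinite_card_square iZ.
have /infiniteP/card_le_setTP[n ninj] := iZ.
have /card_le_setTP[i iinj] : [set: M] #<= [set: Z].
  by apply: card_le_trans MZ; have /card_eqPle[] := card_setT M.
apply/card_le_setTP.
exists (fun y : Y => match y with
  | inl mn => c (n 0%N, c (i mn.1, i mn.2))
  | inr k => c (n 1%N, n k)
  end).
move=> [[m1 m2]|k] [[m1' m2']|k'] /cinj.
- by case=> /cinj[/iinj -> /iinj ->].
- by case=> /ninj.
- by case=> /ninj.
- by case=> /ninj ->.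
Qed.

Section LowerBound.
Context (dK : Order.disp_t) (K : orderType dK).
Context (MK : M #<= [set: K]).

(** If [h m] met no other projection it would be disjoint from the rest of [M], hence equal to
    [m]. *)
Lemma neighbour_ex m : M m -> ~ A m -> exists n, [/\ M n, n <> m & h m `&` h n <> \bot].
Proof.
move=> Mm nAm; apply: contrapT => nn; apply: nAm.
suff -> : m = h m by exact: up_in.
apply: le_anti; rewrite le_up //= -[leLHS]meet1x -M1.
apply: meet_bsup_le => // n Mn; have [->|nm] := pselect (n = m); first exact: leIl.
suff : h m `&` h n = \bot by move: (le_up cB A n); ba B.
by apply: contrapT => mn; apply: nn; exists n.
Qed.

(** The swap of [m] and [n] moves a nonzero element below [m], while a swap not involving [m] fixes
    everything below it. *)
Lemma swap_pair m n m' n' : M m -> M n -> M m' -> M n' -> n <> m ->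
  h m `&` h n <> \bot -> full_swap m n = full_swap m' n' -> m = m' \/ m = n'.
Proof.
move=> Mm Mn Mm' Mn' nm mn0 e; apply: contrapT => /not_orP[nmm' nmn']; apply: mn0.
have mn : m `&` n = \bot by apply: aM.2 => //; exact/nesym.
have mm' := aM.2 _ _ Mm Mm' nmm'; have mn' := aM.2 _ _ Mm Mn' nmn'.
have Ahh : A (h m `&` h n) by apply: subalg_meet => //; exact: up_in.
have := congr1 (fun f => f (h m `&` h n `&` m)) e; rewrite swap_move //; last exact: leIl.
rewrite swap_disjoint; [|exact: cB|exact: sA|by move: mm' mn'; ba B].
move=> e'; have : h (h m `&` h n `&` m) = h \bot by congr h; move: e' mn; ba B.
by rewrite up_bot // up_meet //; ba B.
Qed.

(** Sending [m] to its swap with a chosen neighbour is at most two-to-one: two elements may choose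
    each other. The bit tells them apart by recording which comes first in an embedding [i] of [M]
    into the linear order [K]. *)
Lemma swaps_card (G : set (B -> B)) : (forall m n, M m -> M n -> m <> n -> G (full_swap m n)) ->
  (M `\` A)%classic #<= [set: G * bool].
Proof.
move=> GM; have [M0|/set0P[m0 Mm0]] := eqVneq (M `\` A)%classic set0; first by rewrite M0; exact: card_ge0.
have /choice[nb nbP] : forall m, exists n, (M `\` A)%classic m -> [/\ M n, n <> m & h m `&` h n <> \bot].
  by move=> m; have [[Mm /(neighbour_ex Mm)[n nP]]|?] := pselect ((M `\` A)%classic m); [exists n|exists m].
have [a0 _] : [set: K] !=set0.
  apply/set0P/eqP => K0; move: MK; rewrite K0 => /card_le0P M0.
  by case: Mm0; rewrite M0.
have [i [_ iinj]] := card_le_funP a0 MK.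
pose R m (y : G * bool) := val y.1 = full_swap m (nb m) /\ y.2 = (i m < i (nb m)).
apply: (card_le_rel (R := R)) => [m Mm|m m' [phi b] Mm Mm' [/= e1 b1] [/= e2 b2]].
  have [Mn nm _] := nbP m Mm; have [Mm' _] := Mm.
  have Gmn : G (full_swap m (nb m)) by apply: GM => //; exact/nesym.
  by exists (SigSub (mem_set Gmn), i m < i (nb m)).
have [Mn nm mn0] := nbP m Mm; have [Mn' nm' mn0'] := nbP m' Mm'.
have [[Mm1 _] [Mm1' _]] := (Mm, Mm').
have e : full_swap m (nb m) = full_swap m' (nb m') by rewrite -e1.
have [//|mE] := swap_pair Mm1 Mn Mm1' Mn' nm mn0 e.
have [//|m'E] := swap_pair Mm1' Mn' Mm1 Mn nm' mn0' (esym e).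
move: b2; rewrite b1 -mE -m'E => ii.
apply: iinj => //; have [l|l|//] := ltgtP (i m) (i m').
  by move: ii; rewrite l ltNge (ltW l).
by move: ii; rewrite l ltNge (ltW l).
Qed.

End LowerBound.

(** Swaps over a strictly decreasing sequence of elements of [A] below both projections are
    distinct, since the image of [m] reveals over which element it was swapped. *)
Lemma swap_sequence m n : M m -> M n -> m <> n -> h m `&` h n <> \bot ->
  (forall x, x <> \bot -> exists2 y, y <> \bot & y < x) ->
  exists e : nat -> B -> B, injective e /\
    forall k, [/\ automorphism (e k), cancel (e k) (e k) & forall x, A x -> e k x = x].
Proof.
move=> Mm Mn nmn mn0 atomless; have mn := aM.2 _ _ Mm Mn nmn.
pose P a := [/\ A a, a <> \bot & a <= h m `&` h n].
have /choice[f fP] : forall a, exists a', P a -> P a' /\ a' < a.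
  move=> a; have [[Aa a0 amn]|nP] := pselect (P a); last by exists a.
  have am : a <= h m by apply: le_trans amn (leIl _ _).
  have /atomless[x x0 xam] : a `&` m <> \bot.
    by move=> am0; apply: a0; have := up_meet cB sA m Aa; rewrite am0 up_bot // => /esym; rewrite meet_l.
  have hxa : h x <= a by apply: up_min => //; apply: le_trans (ltW xam) (leIl _ _).
  exists (h x) => _; split.
    split; [exact: up_in| |exact: le_trans hxa amn].
    by move=> /(up_eq0 cB).
  (* If [h x] were [a], then [x], being the trace of [h x] on [m], would be the whole meet of [a]
     and [m]. *)
  rewrite lt_neqAle hxa andbT; apply/eqP => e.
  have xm : x <= m by apply: le_trans (ltW xam) (leIr _ _).
  by move: xam; rewrite -(atM Mm I xm) e ltxx.
pose c k := iter k f (h m `&` h n).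
have cP k : P (c k).
  elim: k => [|k IH]; last exact: (fP _ IH).1.
  by split => //; apply: subalg_meet => //; exact: up_in.
have clt j k : (j < k)%N -> c k < c j.
  elim: k => // k IH; rewrite ltnS leq_eqVlt => /orP[/eqP ->|/IH].
    exact: (fP _ (cP k)).2.
  exact/lt_trans/(fP _ (cP k)).2.
have cinj : injective c.
  by move=> j k e; have [/clt|/clt|//] := ltngtP j k; rewrite e ltxx.
have cm k : c k <= h m by have [_ _] := cP k; rewrite lexI => /andP[].
have cn k : c k <= h n by have [_ _] := cP k; rewrite lexI => /andP[].
have cA k : A (c k) by have [] := cP k.
exists (fun k => swap A m n (c k)); split => [j k e|k].
  apply: cinj; have e' : h m `&` c j `&` n = h m `&` c k `&` n.
    have := congr1 (fun g => g m) e; rewrite /swap meetxx mn up_bot //.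
    by move: mn; ba B.
  have hc i : h (h m `&` c i `&` n) = c i.
    rewrite up_meet; [|exact: cB|exact: sA|by apply: subalg_meet => //; exact: up_in].
    by move: (cm i) (cn i); ba B.
  by rewrite -(hc j) -(hc k) e'.
split => [||x].
- by apply: swap_automorphism => //; exact: atM.
- by apply: swapK => //; exact: atM.
- exact: swap_fixes.
Qed.

End SwapGroup.

(** * Cardinality of the groups in (b) *)

Section LargeGroups.
Context (dK : Order.disp_t) (K : orderType dK) (rK : regular_uncountable K).
Context (d : Order.disp_t) (B : ctbDistrLatticeType d) (cB : complete_algebra B).
Context (ccB : kappa_cc B K).
Context (A : set B) (sA : complete_subalgebra A).

Lemma nat_prod_infinite T : [set: T] !=set0 -> infinite_set [set: nat * T].
Proof. by case=> t0 _; apply/infiniteP/card_le_setTP; exists (fun k => (k, t0)) => k k' []. Qed.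

Lemma large_group M : antichain M -> bsup M = \top -> generates_over A M ->
  exists G : set (B -> B),
    [/\ automorphism_group G, card_lt G [set: K] & A = fixed_points G].
Proof.
move=> aM M1 gM.
have atM m : M m -> relative_atom A setT m by exact: generates_relative_atom.
have [|G [gG AG _ _ Gle]] := swap_group cB sA aM M1 atM (e := fun=> idfun).
  by move=> _; split => //; split => //; exact: set_bij_id.
exists G; split => //.
(* The bound [nat * M] used below is infinite only for nonempty [M]. *)
have [M0|/set0P[m0 Mm0]] := eqVneq M set0.
  apply: (countable_small rK); apply: (Gle nat infinite_nat); rewrite M0; exact: card_ge0.
have smallM : card_lt [set: M] [set: K].
  by apply: card_lt_le (ccB aM); have /card_eqPle[] := card_setT M.
apply: card_lt_le (card_lt_nat_prod _ smallM); last by case: rK.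
apply: Gle; first by apply: nat_prod_infinite; exists (SigSub (mem_set Mm0)).
apply: (card_le_rel (R := fun m y => val y.2 = m)) => [m Mm|m m' y _ _ <- //].
by exists (0%N, SigSub (mem_set Mm)).
Qed.

Lemma large_group_card mu : (forall x : B, x <> \bot -> exists2 y, y <> \bot & y < x) ->
  least_mu_large mu A -> [set: mu] !=set0 ->
  exists G : set (B -> B), [/\ automorphism_group G, card_lt G [set: K],
    A = fixed_points G & G #= [set: nat * mu]].
Proof.
move=> atomless [[M0 [aM0 M0mu gM0]] minmu] [u0 _].
have [M [aM gM M1 M0M MM0]] := antichain_maximize cB aM0 gM0.
have atM m : M m -> relative_atom A setT m by exact: generates_relative_atom.
pose M' := (M `\` A)%classic.
(* Minimality of [mu] is applied to [M'], an antichain that still generates together with [A]. *)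
have mu_M' : [set: mu] #<= M'.
  have : [set: mu] #<= [set: M'].
    apply: minmu; exists M'; split; last 1 first.
    - rewrite /generates_over -subTset -gM; apply: sub_smallest2r.
        by split => [x|S] H X [sX sub]; [apply: subalg_compl => //; exact: H
          | apply: subalg_bsup => // x /H; exact].
      by move=> x [Ax|Mx]; [left|have [Ax|nAx] := pselect (A x); [left|right]].
    - by split => [[/aM.1]|x y [Mx _] [My _]] //; exact: aM.2.
    - exact: card_setT_sym.
  by move/card_le_trans; apply; have /card_eqPle[] := card_setT M'.
have [m [Mm nAm]] : M' !=set0.
  apply/set0P/eqP => M'0; move: mu_M'; rewrite M'0 => /card_le0P mu0.
  by have : [set: mu] u0 by []; rewrite mu0.
have [n [Mn nm mn0]] := neighbour_ex cB sA M1 Mm nAm.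
have [e [einj eP]] := swap_sequence cB sA aM atM Mm Mn (nesym nm) mn0 atomless.
have [G [gG AG Ge GM Gle]] := swap_group cB sA aM M1 atM eP.
have iZ : infinite_set [set: nat * mu] by apply: nat_prod_infinite; exists u0.
have G_le : G #<= [set: nat * mu].
  apply: (Gle _ iZ); have /card_eqPle[/(card_le_funP u0)[i [_ iinj]] _] := M0mu.
  (* [M] exceeds [M0] by at most the complement of its join; the first coordinate 0 is kept for that
     element. *)
  pose R x (y : nat * mu) := M0 x /\ y = (1%N, i x) \/ x = ~` bsup M0 /\ y = (0%N, u0).
  apply: (card_le_rel (R := R)) => [x /MM0[Mx|xE]|x x' y _ _].
  - by exists (1%N, i x) => //; left.
  - by exists (0%N, u0) => //; right.
  by case=> [[Mx ->]|[-> ->]] [[Mx' e']|[-> e']] //; case: e' => /iinj; exact.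
have small_mu : card_lt [set: mu] [set: K].
  by apply: card_lt_le (ccB aM0); have /card_eqPle[] := M0mu.
exists G; split => //.
  by apply: card_lt_le G_le (card_lt_nat_prod _ small_mu); case: rK.
apply/card_eqPle; split => //.
have iG : [set: nat] #<= [set: G].
  apply/card_le_setTP; exists (fun k => SigSub (mem_set (Ge k))) => j k /(congr1 val) /=.
  exact: einj.
suff : [set: nat * mu] #<= [set: G].
  by move/card_le_trans; apply; have /card_eqPle[] := card_setT G.
(* For finite [mu] the sequence [e] alone supplies enough elements. For infinite [mu] the swaps do,
   and the extra bit is absorbed because [G] is infinite. *)
have [fmu|imu] := pselect (finite_set [set: mu]).
  apply: card_le_trans iG; have /card_le_setTP[i iinj] := finite_set_countable fmu.
  apply: card_le_trans (_ : _ #<= [set: nat * nat]) _; last by have/card_eqPle[] := card_nat2.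
  by apply/card_le_setTP; exists (fun p => (p.1, i p.2)) => -[a b] [a' b'] [-> /iinj ->].
have /infiniteP iGs := iG.
have /card_le_setTP[k kinj] := iG.
have /infiniteP/card_le_setTP[l linj] := imu.
apply: card_le_trans (_ : _ #<= [set: mu * mu]) _.
  by apply/card_le_setTP; exists (fun p => (l p.1, p.2)) => -[a b] [a' b'] [/linj -> ->].
apply: card_le_trans (infinite_card_square imu) (card_le_trans mu_M' _).
apply: card_le_trans (swaps_card cB sA aM M1 (ccB aM).1 GM) _.
apply: card_le_trans (infinite_card_square iGs).
apply/card_le_setTP; exists (fun p => (p.1, k (nat_of_bool p.2))) => -[a b] [a' b'] [-> /kinj].
by case: b; case: b'.
Qed.

End LargeGroups.

Theorem theorem3p5 (dK : Order.disp_t) (K : orderType dK)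
    (dB : Order.disp_t) (B : ctbDistrLatticeType dB) (A : set B) :
  regular_uncountable K -> souslin_algebra B K ->
  complete_subalgebra A -> large A ->
  [/\ nice K A,
      (exists G : set (B -> B),
         [/\ automorphism_group G, card_lt G [set: K] & A = fixed_points G]) /\
      (forall mu : Type, least_mu_large mu A -> [set: mu] !=set0 ->
       exists G : set (B -> B),
         [/\ automorphism_group G, card_lt G [set: K], A = fixed_points G
           & G #= [set: nat * mu]]),
      exists (N : set B) (f : N -> Type),
        maximal_antichain_in A N /\
        boolean_isomorphic [set: B] \top
          (product_of_powers A f) (power_top f)
    & homogeneous B -> boolean_isomorphic A \top [set: B] \top].
Proof.
move=> rK [cB ccB disB [T sT]] sA [M0 aM0 gM0].
have [M [aM gM M1 _ _]] := antichain_maximize cB aM0 gM0.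
have atM m : M m -> relative_atom A setT m by exact: generates_relative_atom.
split.
- by apply: (large_nice rK cB ccB disB sA aM M1 atM); exists T.
- split; first by have := large_group rK cB ccB sA aM M1 gM.
  (* Atomlessness comes from the tree: density gives a node below [x], and an immediate successor of
     this node is nonzero and strictly smaller. *)
  move=> mu leastmu mu0; apply: (large_group_card rK cB ccB sA _ leastmu mu0) => // x /(node_below sT)[t Tt tx].
  case: (sT) => _ _ _ [_ [_ /(_ t Tt)[s [_ [[Ts st _] _ _]]] _ _]] _.
  exists s; [exact: node_neq0 sT s Ts|exact: lt_le_trans tx].
- by have := large_product cB ccB disB sA aM M1 atM.
- have [p [pA hp]] := full_relative_atom cB ccB disB sA aM M1 atM.
  move=> homB; apply: (boolean_isomorphic_trans (large_isomorphic_relative cB sA pA hp)).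
  apply: homB => p0; apply: (souslinization_top_neq0 sT).
  by rewrite -hp p0; exact: up_bot.
Qed.
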